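(* Consider the problem $\min_{x\in\mathcal H}F(x)=f(x)+\psi(x)$ described in the context, with $\dim\mathcal H<\infty$, and let the subproblem assumption (see context) hold with some constant $L\ge0$. Let $f$ be twice continuously differentiable and convex in a neighbourhood of some point $x^*$, with $H(x)=\nabla^2f(x)$ there. Let $(x_k)_{k\in\mathbb N}$ be the iterates of the LeAP-SSN algorithm (see context). Denote by (M) the condition: $\|f'(y)-f'(x)-H(x)(y-x)\|_*\le L\|x-y\|$ for all $x,y\in\mathcal H$ (with the same $L$). Then: (i) If $x_k\to x^*$, then $\lambda_k\to0$ as $k\to\infty$. (ii) If (M) holds and $x_k\to x^*$, then $\min_{0\le i\le k-1}\|F'(x_{i+1})\|_*=o(1/\sqrt k)$. (iii) If (M) holds, if for some $\mu>0$ one has $\frac1{2\mu}\operatorname{dist}(0,\partial F(x))^2\ge F(x)-F^*$ for all $x\in\operatorname{dom}F$, and if $x^*$ is the limit of $(x_k)$, then $F(x_k)-F^*$ converges to $0$ superlinearly and $x_k$ converges to $x^*$ superlinearly, where $x^*$ is a global minimiser of $F$. (iv) If (M) holds, the sublevel set $\mathcal F_0=\{x\in\operatorname{dom}F:F(x)\le F(x_0)\}$ is bounded, $F$ is convex on $\mathcal F_0$, and $x_k\to x^*$, then $F(x_k)-F^*=o(1/k)$. (v) Suppose $x^*$ is an isolated local minimum of $F$ and $R>0$, $\mu>0$ are such that for all $x,y\in B_R(x^* )$: $F(x)\ge F(x^* )$ and $\operatorname{dist}(x,S)=\|x-x^*\|$; $\|f'(y)-f'(x)-H(x)(y-x)\|_*\le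 L\|x-y\|$; $\frac1{2\mu}\operatorname{dist}(0,\partial F(x))^2\ge F(x)-F(x^* )$; $H(x)\succeq\mu I$; and $\frac\mu2\operatorname{dist}(x,S)^2\le F(x)-F(x^* )$. Then there exists $\Delta>0$ such that, whenever $x_0\in B_R(x^* )$ and $\|F'(x_0)\|_*\le\Delta$, $x_k$ converges to $x^*$ superlinearly and $F(x_k)$ converges to $F(x^* )$ superlinearly.
   Context: Setting. $\mathcal H$ is a real Hilbert space with norm $\|\cdot\|$, dual $\mathcal H^*$ with norm $\|\cdot\|_*$, duality pairing $\langle\cdot,\cdot\rangle$, and Riesz map $\mathcal R:\mathcal H\to\mathcal H^*$. $f\in C^{1,1}(\mathcal H;\mathbb R)$ (Fréchet differentiable with Lipschitz derivative $f'$, possibly nonconvex); $\psi:\mathcal H\to\mathbb R\cup\{+\infty\}$ is proper, convex, lower semicontinuous; $F=f+\psi$ is bounded below with minimal value $F^*$ and the solution set $S=\{x:F(x)=F^*\}$ is nonempty. $\operatorname{dom}F=\{F<+\infty\}$; $\partial\psi$ is the convex subdifferential and $\partial F(x)=f'(x)+\partial\psi(x)$; $\operatorname{dist}(0,\partial F(x))=\inf\{\|g\|_*:g\in\partial F(x)\}$ ($+\infty$ if $\partial F(x)=\emptyset$); $\operatorname{dist}(x,S)=\inf_{u\in S}\|x-u\|$; $B_R(x)$ is the closed ball. ''$F$ is convex on $\mathcal F_0$'' means $F(tx+(1-t)y)\le tF(x)+(1-t)F(y)$ for all $x,y\in\mathcal F_0$, $t\in[0,1]$. To every $x\in\mathcal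 H$ is associated a symmetric bounded linear operator $H(x):\mathcal H\to\mathcal H^*$; $H(x)\succeq\mu I$ means $\langle H(x)d,d\rangle\ge\mu\|d\|^2$ for all $d\in\mathcal H$. Subproblem. For $x\in\operatorname{dom}F$ and $\lambda\ge0$ let $\widetilde F(y;x,\lambda)=f(x)+\langle f'(x),y-x\rangle+\frac12\langle H(x)(y-x),y-x\rangle+\frac\lambda2\|y-x\|^2+\psi(y)$. A point $x_+=x_+(\lambda,x)$ is an admissible solution if (FO) $-f'(x)-H(x)(x_+-x)-\lambda\mathcal R(x_+-x)\in\partial\psi(x_+)$ and (D) $\widetilde F(x_+;x,\lambda)\le\widetilde F(x;x,\lambda)=F(x)$. For such a point set $\psi'(x_+)=-f'(x)-H(x)(x_+-x)-\lambda\mathcal R(x_+-x)$ and $F'(x_+)=f'(x_+)+\psi'(x_+)\in\partial F(x_+)$. Subproblem assumption (with constant $L$): for all $\lambda\ge L$ and all $x\in\operatorname{dom}F$ an admissible solution exists (and can be computed). LeAP-SSN algorithm. Input: $m\ge1$, $\alpha\in(0,1/2]$, $\beta\in(0,(m-1)/(2m)]$, $x_0\in\operatorname{dom}F$, $\psi'(x_0)\in\partial\psi(x_0)$, $\Lambda_0>0$; $F'(x_0)=f'(x_0)+\psi'(x_0)$. At iteration $k=0,1,\dots$: for $j=0,1,\dots$, set $\lambda=2^j\Lambda_k$; take an admissible solution $x_+=x_+(\lambda,x_k)$ (if none exists, go to the next $j$); if $$\langle F'(x_+),x_k-x_+\rangle\ge\tfrac\alpha\lambda\|F'(x_+)\|_*^2\quad\text{and}\quad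 F(x_k)-F(x_+)\ge\beta\lambda\|x_+-x_k\|^2,$$ accept: set $j_k=j$, $x_{k+1}=x_+$, $\lambda_k=\lambda=2^{j_k}\Lambda_k$, $\Lambda_{k+1}=\lambda_k/2$, $F'(x_{k+1})=F'(x_+)$ and go to iteration $k+1$; otherwise go to the next $j$. A nonnegative sequence $(a_k)$ converges to $0$ superlinearly if $a_{k+1}\le\varepsilon_ka_k$ for all large $k$ with some $\varepsilon_k\to0$; applied to $a_k=\|x_k-x^*\|$ and to objective residuals. *)

(* Defs.v *)
From HB Require Import structures.
From mathcomp Require Import all_boot all_order all_algebra.
From mathcomp Require Import all_classical all_reals all_analysis.
Set Implicit Arguments.
Unset Strict Implicit.
Unset Printing Implicit Defensive.
Import Order.TTheory GRing.Theory Num.Theory.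
Import numFieldNormedType.Exports.
Local Open Scope classical_set_scope.
Local Open Scope ring_scope.

Definition finite_dimensional (R : realType) (V : lmodType R) : Prop :=
  exists (n : nat) (e : 'I_n -> V),
    forall v : V, exists c : 'I_n -> R, v = \sum_(i < n) c i *: e i.

Section Problem.
Context {R : realType} {V : completeNormedModType R}.

(* A Hilbert space is a complete normed module whose norm is induced by the
   inner product [ip]. *)
Definition hilbert_norm (ip : {dot V for idfun}) : Prop :=
  forall x : V, ip x x = `|x| ^+ 2.

(* Elements of the dual are represented by their underlying functions. *)
Definition dual_elt (g : V -> R) : Prop :=
  linear (g : V -> R^o) /\ continuous g.

(* Real-valued supremum: only meaningful on elements of the dual. *)
Definition dual_norm (g : V -> R) : R :=
  sup [set `|g d| | d in [set d : V | `|d| <= 1]].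

Definition riesz (ip : {dot V for idfun}) (x : V) : V -> R := ip x.

(* [B d e] is the pairing of [B d], an element of the dual, with [e]. *)
Definition symmetric_bounded_operator (B : V -> V -> R) : Prop :=
  [/\ forall d, dual_elt (B d),
      forall a d1 d2 e, B (a *: d1 + d2) e = a * B d1 e + B d2 e,
      forall d e, B d e = B e d &
      exists C : R, forall d, dual_norm (B d) <= C * `|d|].

Definition C11 (f : V -> R^o) : Prop :=
  (forall x, differentiable f x) /\
  exists C : R, forall x y,
    dual_norm (fun d => 'd f y d - 'd f x d) <= C * `|y - x|.

(* The remainder f'(y) - f'(x) - H(x)(y - x), an element of the dual. *)
Definition derivative_remainder (f : V -> R^o) (H : V -> V -> V -> R)
    (x y : V) : V -> R :=
  fun d => 'd f y d - 'd f x d - H x (y - x) d.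

(* [H x] is the Frechet derivative at [x] of f' : V -> V^*, where V^* carries
   the dual norm. *)
Definition is_hessian (f : V -> R^o) (H : V -> V -> V -> R) (x : V) : Prop :=
  forall e : R, 0 < e -> \forall y \near x,
    dual_norm (derivative_remainder f H x y) <= e * `|y - x|.

(* Continuity at [x] for the operator norm of bounded maps V -> V^*. *)
Definition operator_continuous_at (H : V -> V -> V -> R) (x : V) : Prop :=
  forall e : R, 0 < e -> \forall y \near x,
    forall d, dual_norm (fun v => H y d v - H x d v) <= e * `|d|.

Definition C2_convex_near (f : V -> R^o) (H : V -> V -> V -> R) (xs : V) :
    Prop :=
  exists2 r : R, 0 < r &
    (forall x, ball xs r x -> is_hessian f H x /\ operator_continuous_at H x) /\
    convex_function (ball xs r) f.

Definition remainder_bound (f : V -> R^o) (H : V -> V -> V -> R) (L : R)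
    (A : set V) : Prop :=
  forall x y, A x -> A y ->
    dual_norm (derivative_remainder f H x y) <= L * `|x - y|.

Definition proper_function (psi : V -> \bar R) : Prop :=
  (forall x, psi x != -oo%E) /\ exists x, psi x != +oo%E.

Definition econvex_on (A : set V) (g : V -> \bar R) : Prop :=
  forall x y (t : R), A x -> A y -> 0 <= t <= 1 ->
    (g (t *: x + (1 - t) *: y)%R <= t%:E * g x + (1 - t)%:E * g y)%E.

Definition subdifferential (psi : V -> \bar R) (x : V) : set (V -> R) :=
  [set g | dual_elt g /\ forall y, (psi x + (g (y - x)%R)%:E <= psi y)%E].

Definition objective (f : V -> R^o) (psi : V -> \bar R) (x : V) : \bar R :=
  ((f x)%:E + psi x)%E.

Definition edom (g : V -> \bar R) : set V := [set x | (g x < +oo)%E].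

Definition objective_subdifferential (f : V -> R^o) (psi : V -> \bar R)
    (x : V) : set (V -> R) :=
  [set (fun d => 'd f x d + g d) | g in subdifferential psi x].

(* dist(0, dF(x)), equal to +oo when dF(x) is empty. *)
Definition subdifferential_dist (f : V -> R^o) (psi : V -> \bar R) (x : V) :
    \bar R :=
  ereal_inf [set (dual_norm g)%:E | g in objective_subdifferential f psi x].

Definition solution_set (f : V -> R^o) (psi : V -> \bar R) (Fstar : R) :
    set V :=
  [set x | objective f psi x = Fstar%:E].

Definition dist_to (A : set V) (x : V) : R := inf [set `|x - u| | u in A].

Definition local_minimum (F : V -> \bar R) (x : V) : Prop :=
  edom F x /\ \forall y \near x, (F x <= F y)%E.

Definition isolated_local_minimum (F : V -> \bar R) (x : V) : Prop :=
  local_minimum F x /\ \forall y \near x, local_minimum F y -> y = x.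

Definition model (f : V -> R^o) (psi : V -> \bar R) (H : V -> V -> V -> R)
    (lambda : R) (x y : V) : \bar R :=
  ((f x + 'd f x (y - x) + 2^-1 * H x (y - x) (y - x)
    + lambda / 2 * `|y - x| ^+ 2)%:E + psi y)%E.

(* psi'(x_+) for x_+ obtained from [x] with parameter [lambda]. *)
Definition psi_step (ip : {dot V for idfun}) (f : V -> R^o)
    (H : V -> V -> V -> R) (lambda : R) (x xp : V) : V -> R :=
  fun d => - 'd f x d - H x (xp - x) d - lambda * riesz ip (xp - x) d.

(* F'(x_+) *)
Definition F_step (ip : {dot V for idfun}) (f : V -> R^o)
    (H : V -> V -> V -> R) (lambda : R) (x xp : V) : V -> R :=
  fun d => 'd f xp d + psi_step ip f H lambda x xp d.

Definition admissible (ip : {dot V for idfun}) (f : V -> R^o)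
    (psi : V -> \bar R) (H : V -> V -> V -> R) (lambda : R) (x xp : V) : Prop :=
  subdifferential psi xp (psi_step ip f H lambda x xp) /\
  (model f psi H lambda x xp <= model f psi H lambda x x)%E.

Definition subproblem_assumption (ip : {dot V for idfun}) (f : V -> R^o)
    (psi : V -> \bar R) (H : V -> V -> V -> R) (L : R) : Prop :=
  forall (lambda : R) (x : V), L <= lambda -> edom (objective f psi) x ->
    exists xp, admissible ip f psi H lambda x xp.

Definition accepted (ip : {dot V for idfun}) (f : V -> R^o)
    (psi : V -> \bar R) (H : V -> V -> V -> R) (alpha beta lambda : R)
    (x xp : V) : Prop :=
  alpha / lambda * dual_norm (F_step ip f H lambda x xp) ^+ 2
    <= F_step ip f H lambda x xp (x - xp) /\
  ((beta * lambda * `|xp - x| ^+ 2)%:E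
    <= objective f psi x - objective f psi xp)%E.

(* The admissible solution taken by the algorithm is not unique in general, so
   a trial value may fail because of the particular solution taken. *)
Definition trial_fails (ip : {dot V for idfun}) (f : V -> R^o)
    (psi : V -> \bar R) (H : V -> V -> V -> R) (alpha beta lambda : R)
    (x : V) : Prop :=
  (~ exists xp, admissible ip f psi H lambda x xp) \/
  exists xp, admissible ip f psi H lambda x xp /\
             ~ accepted ip f psi H alpha beta lambda x xp.

(* The value Lambda_k starting the inner loop of iteration [k]. *)
Definition initial_trial (Lambda0 : R) (lambda : nat -> R) (k : nat) : R :=
  if k is k'.+1 then lambda k' / 2 else Lambda0.

(* [x], [dF] and [lambda] are the sequences x_k, F'(x_k) and lambda_k of an
   infinite execution. *)
Record leap_ssn_run (ip : {dot V for idfun}) (f : V -> R^o)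
    (psi : V -> \bar R) (H : V -> V -> V -> R) (alpha beta Lambda0 : R)
    (x : nat -> V) (dF : nat -> V -> R) (lambda : nat -> R) : Prop :=
  LeapSsnRun {
    run_dom : edom (objective f psi) (x 0%N) ;
    run_dF0 : objective_subdifferential f psi (x 0%N) (dF 0%N) ;
    run_step : forall k, exists j : nat,
      [/\ lambda k = 2 ^+ j * initial_trial Lambda0 lambda k,
          forall i, (i < j)%N -> trial_fails ip f psi H alpha beta
            (2 ^+ i * initial_trial Lambda0 lambda k) (x k),
          admissible ip f psi H (lambda k) (x k) (x k.+1),
          accepted ip f psi H alpha beta (lambda k) (x k) (x k.+1) &
          dF k.+1 = F_step ip f H (lambda k) (x k) (x k.+1)] }.

End Problem.

Definition superlinear (R : realType) (a : nat -> R) : Prop :=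
  exists eps : nat -> R, eps @ \oo --> (0 : R) /\
    \forall k \near \oo, a k.+1 <= eps k * a k.

(* Main.v *)
Require Import Defs.
From HB Require Import structures.
From mathcomp Require Import all_boot all_order all_algebra.
From mathcomp Require Import all_classical all_reals all_analysis.
From mathcomp Require Import ring lra.
Set Implicit Arguments.
Unset Strict Implicit.
Unset Printing Implicit Defensive.
Import Order.TTheory GRing.Theory Num.Theory.
Import numFieldNormedType.Exports.
Local Open Scope classical_set_scope.
Local Open Scope ring_scope.

(** Write [d_k = x_{k+1} - x_k]. The two acceptance tests give, for every accepted
    step, the gradient bound [alpha * |F'(x_{k+1})| <= lambda_k * |d_k|]
    ([run_dual_norm]) and the descent [beta * lambda_k * |d_k|^2 <= F(x_k) - F(x_{k+1})]
    ([run_decrease]). All the rates follow from these two inequalities as soon as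
    [lambda_k] tends to 0.

    The parameters vanish because the Newton model becomes exact. Near [xs] the
    operators [H x] are nonnegative, so every [lambda > 0] admits a trial point
    ([exists_admissible]), and monotonicity of the subdifferential of [psi] bounds it:
    [lambda * |x_+ - x_k| <= |F'(x_k)|] ([admissible_step_le]). All the values of
    [lambda] tried at iteration [k] are at least [lambda_{k-1} / 2], so the gradient
    bound makes the trial steps at most [2 / alpha * |d_{k-1}|], and the trial points
    converge to [xs] with the iterates. In a small ball around [xs] the remainder
    [f'(y) - f'(x) - H(x)(y - x)] is at most [e * |y - x|] ([uniform_remainder]). Since
    [F'(x_+)] is that remainder minus [lambda] times the Riesz image of the step, both
    tests succeed as soon as [lambda >= 2 * e] ([accepted_of_small_remainder]). Hence
    [lambda_k <= max (lambda_{k-1} / 2) (4 * e)] eventually, for every [e > 0]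
    ([run_lambda_le], [run_lambda_cvg0]).

    Together the two inequalities give
    [|F'(x_{k+1})|^2 <= C * lambda_k * (F(x_k) - F(x_{k+1}))]
    ([run_dual_norm_decrease]). Summing it yields the rate of the smallest gradient
    ([bigmin_rate]). If [F] is convex on a bounded sublevel set, the residual is at most
    a constant times [|F'(x_{k+1})|], and its square is controlled by its decrease
    ([quadratic_decrease_rate]). Under the Polyak-Lojasiewicz inequality the residual is
    at most a constant times [|F'(x_{k+1})|^2], hence
    [F(x_{k+1}) - Fstar <= C' * lambda_k * (F(x_k) - Fstar)]; comparing the residual at
    [x_{k+1}] with the descent of the next step also gives
    [|d_{k+1}|^2 <= C'' * lambda_k * |d_k|^2], and steps that shrink superlinearly force
    superlinear convergence of the iterates ([run_iterates_superlinear]).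

    For the local statement convergence has to be proved as well: a small initial
    subgradient, descent and quadratic growth confine the iterates to a small ball
    ([run_confined]). The parameters then remain bounded, the residuals tend to 0 by
    the Polyak-Lojasiewicz inequality, and quadratic growth brings [x_k] to [xs]
    ([run_confined_cvg]). *)

(** * Convex combinations and elementary estimates *)

Section Elementary.
Context {R : realType}.

Lemma convex_comb_line (U : lmodType R) (x y : U) (t : R) :
  t *: y + (1 - t) *: x = x + t *: (y - x).
Proof. by rewrite scalerBr scalerBl scale1r addrCA addrA. Qed.

Lemma line_end (U : lmodType R) (x y : U) : x + (1 : R) *: (y - x) = y.
Proof. by rewrite scale1r addrCA subrr addr0. Qed.

Lemma dist_le_add_dist (U : normedModType R) (c a b : U) :
  `|a - b| <= `|a - c| + `|b - c|.
Proof. by rewrite [`|b - c|]distrC ler_distD. Qed.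

Lemma le_of_vanishing_slope (a b n : R) : 0 <= n ->
  (forall e, 0 < e -> a - e * n <= b) -> a <= b.
Proof.
move=> n0 key; apply/ler_addgt0Pr => e e0.
have n1 : 0 < n + 1 by rewrite ltr_wpDl.
have := key _ (divr_gt0 e0 n1).
suff : e / (n + 1) * n <= e by lra.
by rewrite mulrAC ler_pdivrMr// ler_wpM2l ?(ltW e0)// lerDl.
Qed.

Lemma small_multiple (U : normedModType R) (d : U) (r : R) : 0 < r ->
  exists2 t : R, 0 < t <= 1 & `|t *: d| < r.
Proof.
move=> r0; exists (r / (r + `|d| + 1)).
  have D0 : 0 < r + `|d| + 1 by rewrite ltr_wpDl// addr_ge0// ltW.
  rewrite divr_gt0//= ler_pdivrMr// mul1r; have := normr_ge0 d; lra.
have D0 : 0 < r + `|d| + 1 by rewrite ltr_wpDl// addr_ge0// ltW.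
rewrite normrZ gtr0_norm ?divr_gt0// mulrAC ltr_pdivrMr//.
by rewrite ltr_pM2l//; lra.
Qed.

Lemma near_ooP (P : nat -> Prop) :
  (\forall n \near \oo, P n) <-> exists N, forall n, (N <= n)%N -> P n.
Proof. by split=> [[N _ NP]|[N NP]]; exists N. Qed.

Lemma cvg_ooP (U : normedModType R) (u : nat -> U) (l : U) :
  u @ \oo --> l <->
  forall e : R, 0 < e -> exists N, forall n, (N <= n)%N -> `|u n - l| < e.
Proof.
split=> [/cvgrPdist_lt ul e /ul/near_ooP[N NP]|ul].
  by exists N => n /NP; rewrite distrC.
apply/cvgrPdist_lt => e /ul[N NP]; apply/near_ooP; exists N => n /NP.
by rewrite distrC.
Qed.

Lemma nearP_norm (U : normedModType R) (x : U) (P : U -> Prop) :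
  (\forall y \near x, P y) -> exists2 d : R, 0 < d & forall y, `|y - x| < d -> P y.
Proof.
move=> /nbhs_ballP[d /= d0 dP]; exists d => // y yx; apply: dP.
by rewrite -ball_normE /= distrC.
Qed.

End Elementary.

(** * The dual space *)

Section Dual.
Context {R : realType} {V : completeNormedModType R}.
Implicit Types (g : V -> R) (x y : V).

Lemma dual_eltP g : dual_elt g -> forall (a : R) x y, g (a *: x + y) = a * g x + g y.
Proof. by move=> [gl _] a x y; apply: gl. Qed.

Lemma dual_eltD g : dual_elt g -> {morph g : x y / x + y}.
Proof. by move=> gd x y; rewrite -[x]scale1r dual_eltP// scale1r mul1r. Qed.

Lemma dual_elt0 g : dual_elt g -> g 0 = 0.
Proof. by move=> gd; have := dual_eltD gd 0 0; rewrite addr0; lra. Qed.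

Lemma dual_eltZ g : dual_elt g -> forall (a : R) x, g (a *: x) = a * g x.
Proof. by move=> gd a x; rewrite -[a *: x]addr0 dual_eltP// dual_elt0// addr0. Qed.

Lemma dual_eltN g : dual_elt g -> {morph g : x / - x}.
Proof. by move=> gd x; rewrite -scaleN1r dual_eltZ// mulN1r. Qed.

Lemma dual_eltB g : dual_elt g -> {morph g : x y / x - y}.
Proof. by move=> gd x y; rewrite dual_eltD// dual_eltN. Qed.

Lemma dual_elt_comb g h (a : R) : dual_elt g -> dual_elt h ->
  dual_elt (fun d => g d + a * h d).
Proof.
move=> gd hd; split.
  by move=> b x y; rewrite (dual_eltP gd) (dual_eltP hd) /GRing.scale/=; ring.
move=> x; apply: (@cvgD _ R^o); first exact: gd.2.
by apply: cvgM; [exact: cvg_cst|exact: hd.2].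
Qed.

Lemma dual_elt_add g h : dual_elt g -> dual_elt h ->
  dual_elt (fun d => g d + h d).
Proof.
move=> gd hd; have := dual_elt_comb 1 gd hd.
by congr dual_elt; apply/funext => d; rewrite mul1r.
Qed.

Lemma dual_elt_sub g h : dual_elt g -> dual_elt h ->
  dual_elt (fun d => g d - h d).
Proof.
move=> gd hd; have := dual_elt_comb (-1) gd hd.
by congr dual_elt; apply/funext => d; rewrite mulN1r.
Qed.

Lemma dual_elt_opp g : dual_elt g -> dual_elt (fun d => - g d).
Proof.
move=> gd; have := dual_elt_sub (dual_elt_sub gd gd) gd.
by congr dual_elt; apply/funext => d; rewrite subrr sub0r.
Qed.

Lemma dual_elt_bounded g : dual_elt g ->
  exists2 C : R, 0 <= C & forall x, `|g x| <= C * `|x|.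
Proof.
move=> [gl gc].
pose gm := GRing.isLinear.Build R V R^o *:%R g gl.
pose gL : {linear V -> R^o} := HB.pack g gm.
have /linear_boundedP/pinfty_ex_gt0[r r0 rb] : bounded_near gL (nbhs 0).
  exact/linear_bounded_continuous.
by exists r => //; exact: ltW.
Qed.

Lemma dual_norm_has_sup g : dual_elt g ->
  has_sup [set `|g d| | d in [set d : V | `|d| <= 1]].
Proof.
move=> gd; split; first by exists `|g 0|, 0 => //=; rewrite normr0.
have [C C0 gC] := dual_elt_bounded gd; exists C => _ [d /= d1 <-].
by rewrite (le_trans (gC d))// ler_piMr.
Qed.

Lemma dual_norm_ge0 g : dual_elt g -> 0 <= dual_norm g.
Proof.
move=> gd; apply: le_trans (sup_ubound (dual_norm_has_sup gd).2 _); last first.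
  by exists 0 => //=; rewrite normr0.
exact: normr_ge0.
Qed.

Lemma dual_normP g x : dual_elt g -> `|g x| <= dual_norm g * `|x|.
Proof.
move=> gd; have [->|x0] := eqVneq x 0.
  by rewrite dual_elt0// !normr0 mulr0.
have nx : 0 < `|x| by rewrite normr_gt0.
rewrite -ler_pdivrMr//.
apply: le_trans (sup_ubound (dual_norm_has_sup gd).2 _); last first.
  exists (`|x|^-1 *: x) => //=.
  by rewrite normrZ gtr0_norm ?invr_gt0// mulVf ?gt_eqF.
by rewrite dual_eltZ// normrM gtr0_norm ?invr_gt0// mulrC.
Qed.

Lemma dual_norm_le g (c : R) : 0 <= c -> (forall x, `|g x| <= c * `|x|) ->
  dual_norm g <= c.
Proof.
move=> c0 gc; apply: ge_sup; first by exists `|g 0|, 0 => //=; rewrite normr0.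
by move=> _ [d /= d1 <-]; rewrite (le_trans (gc d))// ler_piMr.
Qed.

End Dual.

(** * Strongly convex minimisation *)

Section Minimisation.
Context {R : realType} {V : completeNormedModType R}.
Implicit Types (psi : V -> \bar R).

Lemma lsc_seq psi (u : nat -> V) (x : V) (c : nat -> R) (l : R) :
  lower_semicontinuous psi -> u @ \oo --> x -> c @ \oo --> l ->
  (forall n, (psi (u n) <= (c n)%:E)%E) -> (psi x <= l%:E)%E.
Proof.
move=> lsc ux cl uc; rewrite leNgt; apply/negP => lx.
have [a la ax] : exists2 a : R, l < a & (a%:E < psi x)%E.
  case: (psi x) lx => [r|_|//].
    rewrite lte_fin => lr; exists ((l + r) / 2); first lra.
    by rewrite lte_fin; lra.
  by exists (l + 1); [lra|rewrite ltry].
have [W Wx Wa] := lsc _ _ ax.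
have [N NP] := (near_ooP _).1 (ux _ Wx).
have [M MP] := (near_ooP _).1 (cvgr_lt l cl a la).
have := lt_le_trans (Wa _ (NP _ (leq_maxl N M))) (uc _).
by rewrite lte_fin; have := MP _ (leq_maxr N M); lra.
Qed.

(** Upper bounds by reals, rather than values, keep the infinite values of [psi] out
    of the computations. *)
Lemma econvex_epi psi y z (r s t : R) : econvex_on setT psi ->
  (psi y <= r%:E)%E -> (psi z <= s%:E)%E -> 0 <= t <= 1 ->
  (psi (t *: y + (1 - t) *: z)%R <= (t * r + (1 - t) * s)%:E)%E.
Proof.
move=> cvx yr zs t01; apply: le_trans (cvx _ _ _ _ _ t01) _ => //.
case/andP: t01 => t0 t1.
rewrite [leRHS]EFinD !EFinM; apply: leeD.
  by apply: lee_wpmul2l => //; rewrite lee_fin.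
by apply: lee_wpmul2l => //; rewrite lee_fin subr_ge0.
Qed.

Variables (psi : V -> \bar R) (g : V -> R) (B : V -> V -> R) (lam : R).
Hypotheses (psiP : proper_function psi) (psi_cvx : econvex_on setT psi)
  (psi_lsc : lower_semicontinuous psi) (gd : dual_elt g)
  (Bd : forall d, dual_elt (B d)) (Bsym : forall d e, B d e = B e d)
  (lam0 : 0 < lam) (Blam : forall d, lam * `|d| ^+ 2 <= B d d).

Let Q y := g y + B y y / 2.

Lemma quadratic_lineE x d (t : R) :
  Q (x + t *: d) = Q x + t * (g d + B x d) + t ^+ 2 / 2 * B d d.
Proof.
have BD a b c e : B (a + b) (c + e) = B a c + B a e + B b c + B b e.
  rewrite (dual_eltD (Bd _)) ![B (a + b) _]Bsym !(dual_eltD (Bd _)).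
  by rewrite !(Bsym _ a) !(Bsym _ b); lra.
rewrite /Q (dual_eltD gd) (dual_eltZ gd) BD !(dual_eltZ (Bd _)) [B (_ *: _) x]Bsym.
rewrite [B (_ *: _) _]Bsym !(dual_eltZ (Bd _)); lra.
Qed.

Lemma coercive_ge0 d : 0 <= B d d.
Proof. by apply: le_trans (Blam d); rewrite mulr_ge0 ?sqr_ge0// ltW. Qed.

(** A subgradient is an affine minorant of [psi], and a coercive quadratic dominates
    every affine function. *)
Lemma quadratic_plus_convex_bounded z0 p : subdifferential psi z0 p ->
  exists m : R, forall y r, (psi y <= r%:E)%E -> m <= Q y + r.
Proof.
move=> [pd ps].
have [ppsi [y0 y0fin]] := psiP.
have [r0 r0E] : exists r0, psi z0 = r0%:E.
  move: (ps y0) (ppsi y0) (ppsi z0) y0fin.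
  by case: (psi z0) => [r| |]; case: (psi y0) => // *; exists r.
have [C C0 gpC] := dual_elt_bounded (dual_elt_add gd pd).
exists (r0 - p z0 - C ^+ 2 / (2 * lam)) => y r yr.
have := le_trans (ps y) yr; rewrite r0E -EFinD lee_fin (dual_eltB pd) => h.
have := gpC y; rewrite ler_norml => /andP[h1 _].
have h2 := Blam y.
suff : 0 <= C ^+ 2 / (2 * lam) - C * `|y| + lam / 2 * `|y| ^+ 2 by rewrite /Q; lra.
have -> : C ^+ 2 / (2 * lam) - C * `|y| + lam / 2 * `|y| ^+ 2
   = lam / 2 * (`|y| - C / lam) ^+ 2 by field; rewrite gt_eqF.
by rewrite mulr_ge0 ?sqr_ge0 ?divr_ge0 ?ltW.
Qed.

(** Strong convexity makes every minimising sequence Cauchy, so completeness and lower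
    semicontinuity provide the minimiser. Its optimality condition comes from comparing
    [xp] with the points [xp + t *: (y - xp)] as [t] tends to 0. *)
Lemma strongly_convex_minimiser z0 p : subdifferential psi z0 p ->
  exists xp, subdifferential psi xp (fun d => - g d - B xp d) /\
    forall y, ((Q xp)%:E + psi xp <= (Q y)%:E + psi y)%E.
Proof.
move=> sub0; have [m0 m0P] := quadratic_plus_convex_bounded sub0.
have [ppsi [y0 y0fin]] := psiP.
pose E := [set v : R | exists y, (psi y <= (v - Q y)%:E)%E].
have E0 : E !=set0.
  exists (Q y0 + fine (psi y0)), y0; rewrite addrC addKr fineK//.
  by rewrite fin_numE ppsi y0fin.
have lbE : has_lbound E by exists m0 => v [y /m0P]; lra.
have Einf : has_inf E by split.
set m := inf E.
have mP y r : (psi y <= r%:E)%E -> m <= Q y + r.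
  by move=> yr; apply: ge_inf => //; exists y; rewrite addrC addKr.
have /choice[u uP] : forall n, exists y, (psi y <= (m + harmonic n - Q y)%:E)%E.
  move=> n; have [|v [y vy] vm] := @inf_adherent _ E (harmonic n) _ Einf.
    exact: harmonic_gt0.
  by exists y; rewrite (le_trans vy)// lee_fin; rewrite /m; lra.
have half01 : 0 <= (2^-1 : R) <= 1 by apply/andP; split; lra.
(* the value at the midpoint is at least [m], and the quadratic gains a multiple of
   the squared distance there *)
have u_close i j : lam / 4 * `|u i - u j| ^+ 2 <= harmonic i + harmonic j.
  have := mP _ _ (econvex_epi psi_cvx (uP i) (uP j) half01).
  have -> : 2^-1 *: u i + (1 - 2^-1) *: u j = u j + 2^-1 *: (u i - u j).
    exact: convex_comb_line.
  have -> : Q (u i) = Q (u j + 1 *: (u i - u j)) by rewrite line_end.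
  rewrite !quadratic_lineE; have := Blam (u i - u j); lra.
have u_cvg : cvg (u @ \oo).
  apply/cauchy_cvgP/cauchyP => e e0.
  have [N NP] := (cvg_ooP _ _).1 (@cvg_harmonic R) (lam * e ^+ 2 / 8)
    (divr_gt0 (mulr_gt0 lam0 (exprn_gt0 _ e0)) (ltr0n _ 8)).
  exists (u N); apply/near_ooP; exists N => n Nn.
  rewrite -ball_normE /=.
  have := NP _ (leqnn N); have := NP _ Nn; rewrite !subr0 !ger0_norm ?harmonic_ge0//.
  move=> h1 h2; have := u_close N n => h3.
  rewrite -(@ltr_pXn2r _ 2%N) ?nnegrE ?normr_ge0 ?(ltW e0)//.
  rewrite -(ltr_pM2l (_ : 0 < lam / 4)); [|by rewrite divr_gt0]; lra.
set xp := lim (u @ \oo).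
have [C C0 QC] := dual_elt_bounded (dual_elt_add gd (Bd xp)).
have xpE : (psi xp <= (m - Q xp)%:E)%E.
  apply: (@lsc_seq _ u xp (fun n => m + harmonic n - Q xp + C * `|u n - xp|)) => //.
    rewrite -[X in _ --> X]addr0; apply: cvgD.
      rewrite -[X in _ --> X - _]addr0; apply: cvgB; last exact: cvg_cst.
      by apply: cvgD; [exact: cvg_cst|exact: cvg_harmonic].
    rewrite -[X in _ --> X](mulr0 C); apply: cvgM; first exact: cvg_cst.
    rewrite -[X in _ --> X](@normr0 _ V) -(subrr xp).
    by apply: cvg_norm; apply: cvgB => //; exact: cvg_cst.
  move=> n; rewrite (le_trans (uP n))// lee_fin.
  have -> : Q (u n) = Q (xp + 1 *: (u n - xp)) by rewrite line_end.
  rewrite quadratic_lineE.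
  have := QC (u n - xp); rewrite ler_norml => /andP[h _].
  have := coercive_ge0 (u n - xp); lra.
have [r xr] : exists r, psi xp = r%:E.
  by move: xpE (ppsi xp); case: (psi xp) => [s| |] // *; exists s.
have rE : r = m - Q xp.
  apply/eqP; rewrite eq_le; move: xpE; rewrite xr lee_fin => -> /=.
  by have := mP xp r; rewrite xr lexx => /(_ isT); lra.
exists xp; split.
- split.
    exact: dual_elt_sub (dual_elt_opp gd) (Bd xp).
  move=> y; rewrite xr -EFinD; move: (ppsi y); case yE : (psi y) => [s| |] // _.
    rewrite lee_fin.
    have step t : 0 < t <= 1 ->
        0 <= s - r + (g (y - xp) + B xp (y - xp)) + t / 2 * B (y - xp) (y - xp).
      move=> /andP[t0 t1].
      have t01 : 0 <= t <= 1 by rewrite ltW.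
      have := @econvex_epi psi y xp s r t psi_cvx.
      rewrite yE xr !lexx => /(_ isT isT t01) /mP.
      rewrite convex_comb_line quadratic_lineE => h; rewrite -(pmulr_rge0 _ t0); lra.
    set b := B (y - xp) (y - xp) in step.
    have b0 : 0 <= b by apply: coercive_ge0.
    apply: (le_of_vanishing_slope b0) => e e0.
    have [t t01 te] : exists2 t : R, 0 < t <= 1 & t / 2 <= e.
      exists (Num.min 1 e); first by rewrite lt_min ltr01 e0 ge_min lexx.
      have : Num.min 1 e <= e by rewrite ge_min lexx orbT.
      lra.
    have := step t t01; have : t / 2 * b <= e * b by rewrite ler_wpM2r.
    lra.
  by rewrite leey.
- move=> y; rewrite xr -EFinD; move: (ppsi y); case yE : (psi y) => [s| |] // _.
    rewrite -EFinD lee_fin; have := mP y s; rewrite yE lexx => /(_ isT); lra.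
  by rewrite addey// leey.
Qed.

End Minimisation.

(** * The Riesz isometry *)

Section Riesz.
Context {R : realType} {V : completeNormedModType R}.
Variables (ip : {dot V for idfun}).
Hypothesis ipn : hilbert_norm ip.

Lemma ipC x y : ip x y = ip y x.
Proof. by rewrite hermC expr0 mul1r. Qed.

Lemma ipZl a x y : ip (a *: x) y = a * ip x y.
Proof. exact: linearZl_LR. Qed.

Lemma ipZr a x y : ip x (a *: y) = a * ip x y.
Proof. exact: linearZr_LR. Qed.

Lemma ipDr x y z : ip x (y + z) = ip x y + ip x z.
Proof. exact: linearDr. Qed.

Lemma ipBl x y z : ip (x - y) z = ip x z - ip y z.
Proof. exact: linearBl. Qed.

Lemma ipBr x y z : ip x (y - z) = ip x y - ip x z.
Proof. exact: linearBr. Qed.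

Lemma ip_normr_le x y : `|ip x y| <= `|x| * `|y|.
Proof.
have key a b : ip a b <= `|a| * `|b|.
  have [->|a0] := eqVneq a 0; first by rewrite linear0l normr0 mul0r.
  have na : 0 < `|a| by rewrite normr_gt0.
  have [->|b0] := eqVneq b 0; first by rewrite linear0r normr0 mulr0.
  have nb : 0 < `|b| by rewrite normr_gt0.
  have := sqr_ge0 `| `|b| *: a - `|a| *: b |.
  rewrite -ipn ipBl !ipBr !ipZl !ipZr.
  rewrite !ipn [ip b a]ipC => h.
  rewrite -(ler_pM2l (mulr_gt0 na nb)); lra.
rewrite ler_norml key andbT lerNl.
by have := key (- x) y; rewrite normrN; congr (_ <= _); exact: linearNl.
Qed.

Lemma dual_elt_ip x : dual_elt (ip x).
Proof.
split; first by move=> a u v; rewrite ipDr ipZr.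
move=> y; apply/cvgrPdist_lt => e e0; near=> z.
rewrite -ipBr (le_lt_trans (ip_normr_le _ _))//.
apply: le_lt_trans (_ : (`|x| + 1) * `|y - z| < e); first by rewrite ler_wpM2r// lerDl.
rewrite mulrC -ltr_pdivlMr ?ltr_wpDl//; near: z.
by apply: cvgr_dist_lt => //; rewrite divr_gt0 ?ltr_wpDl.
Unshelve. all: by end_near. Qed.

Lemma dual_norm_ip x : dual_norm (ip x) = `|x|.
Proof.
apply/eqP; rewrite eq_le dual_norm_le//=; last exact: ip_normr_le.
have [->|x0] := eqVneq x 0; first by rewrite normr0 dual_norm_ge0//; exact: dual_elt_ip.
have nx : 0 < `|x| by rewrite normr_gt0.
rewrite -(ler_pM2r nx); apply: le_trans (dual_normP x (dual_elt_ip x)).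
by rewrite ipn ger0_norm ?sqr_ge0.
Qed.

(** The representative is the minimiser of [fun y => ip y y / 2 - g y]. *)
Lemma riesz_representation g : dual_elt g -> exists u, g = ip u.
Proof.
move=> gd.
have sub0 : subdifferential (fun _ : V => (0 : \bar R)%E) 0 (fun=> 0).
  split; last by move=> y; rewrite add0e.
  split; first by move=> a u v; rewrite scaler0 addr0.
  by move=> y; exact: cvg_cst.
have [||||||||u [[ud us] _]] := @strongly_convex_minimiser R V (fun=> 0%E)
  (fun d => - g d) ip 1 _ _ _ _ _ _ _ _ _ _ sub0.
- by split=> [//|]; exists 0.
- by move=> x y t _ _ _; rewrite !mule0 adde0.
- by move=> x a a0; exists setT => //; exact: filterT.
- exact: dual_elt_opp.
- exact: dual_elt_ip.
- exact: ipC.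
- exact: ltr01.
- by move=> d; rewrite mul1r ipn.
exists u; apply/funext => d; apply/eqP; rewrite eq_le.
have := us (u + d); have := us (u - d).
rewrite !add0e !lee_fin addrAC subrr add0r addrAC subrr add0r opprK.
rewrite (dual_eltN gd) linearNr; lra.
Qed.

(** The dual norm is Hilbertian by the Riesz isometry; this expansion turns the
    gradient acceptance test into a comparison of squares. *)
Lemma dual_norm_comb g (lam : R) d : dual_elt g ->
  dual_norm (fun e => g e - lam * ip d e) ^+ 2 =
  dual_norm g ^+ 2 - 2 * lam * g d + lam ^+ 2 * `|d| ^+ 2.
Proof.
move=> /riesz_representation[u ->].
have -> : (fun e => ip u e - lam * ip d e) = ip (u - lam *: d).
  by apply/funext => e; rewrite ipBl ipZl.
rewrite !dual_norm_ip -!ipn ipBl !ipBr !ipZl !ipZr.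
rewrite [ip d u]ipC; lra.
Qed.

End Riesz.

(** * Local convexity and the second derivative *)

Section Local.
Context {R : realType} {V : completeNormedModType R}.
Implicit Types (f : V -> R^o) (H : V -> V -> V -> R).

Lemma dual_elt_diff f x : differentiable f x -> dual_elt ('d f x).
Proof. by move=> fx; split; [exact: linearP|exact: diff_continuous]. Qed.

Lemma diff_first_order f x (e : R) : differentiable f x -> 0 < e ->
  exists2 d : R, 0 < d & forall h, `|h| < d ->
    `|f (x + h) - f x - 'd f x h| <= e * `|h|.
Proof.
move=> /diff_locallyP[_ /eqaddoP fx] e0.
have [d d0 dP] := nearP_norm (fx _ e0).
exists d => // h hd; have := dP h; rewrite subr0 => /(_ hd) /=.
by rewrite !fctE /= [h + x]addrC opprD addrA.
Qed.

(** Convexity along the segment from [y] to [x], divided by the parameter of the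
    segment as it tends to 0. *)
Lemma convex_gradient f xs r x y : (forall x, differentiable f x) ->
  convex_function (ball xs r) f -> ball xs r x -> ball xs r y ->
  f y + 'd f y (x - y) <= f x.
Proof.
move=> fd cvx xb yb.
rewrite -lerBrDl; apply: (le_of_vanishing_slope (normr_ge0 (x - y))) => e.
move=> e0; have [d d0 dP] := diff_first_order (fd y) e0.
have [t t01 td] := small_multiple (x - y) d0.
have /andP[t0 t1] := t01.
have := dP _ td; rewrite (dual_eltZ (dual_elt_diff (fd y))) normrZ gtr0_norm//.
move=> /ler_normlP[h _].
have := cvx (Itv01 (ltW t0) t1) x y.
rewrite !inE => /(_ xb yb); rewrite convRE.
set z := (X in f X); have -> : z = y + t *: (x - y).
  by rewrite -convex_comb_line.
rewrite /unstable.onem /= => h2; rewrite -(ler_pM2l t0).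
lra.
Qed.

Lemma dual_elt_remainder f H x y : (forall x, differentiable f x) ->
  symmetric_bounded_operator (H x) -> dual_elt (derivative_remainder f H x y).
Proof.
move=> fd [Hd _ _ _].
exact: dual_elt_sub (dual_elt_sub (dual_elt_diff (fd y)) (dual_elt_diff (fd x))) (Hd _).
Qed.

Lemma symmetric_operatorZl (B : V -> V -> R) a d e :
  symmetric_bounded_operator B -> B (a *: d) e = a * B d e.
Proof. by move=> [Bd _ Bs _]; rewrite Bs (dual_eltZ (Bd _)) Bs. Qed.

(** The derivative of a convex function is monotone, and [H x d d] is the limit of the
    difference quotients of the derivative along [d]. *)
Lemma convex_hessian_ge0 f H xs r x d : (forall x, differentiable f x) ->
  symmetric_bounded_operator (H x) ->
  convex_function (ball xs r) f -> ball xs r x -> is_hessian f H x ->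
  0 <= H x d d.
Proof.
move=> fd Hx cvx xb hess.
apply: (le_of_vanishing_slope (sqr_ge0 `|d|)) => e; rewrite sub0r -mulNr.
move=> e0; have [r1 r10 r1P] := nearP_norm (hess _ e0).
have [r2 r20 r2P] : exists2 r2 : R, 0 < r2 & forall y, `|y - x| < r2 -> ball xs r y.
  by apply: nearP_norm; have /open_nbhs_nbhs := conj (@ball_open _ _ xs r) xb.
have r120 : 0 < Num.min r1 r2 by rewrite lt_min r10.
have [t /andP[t0 _]] := small_multiple d r120; rewrite lt_min => /andP[t1 t2].
set y := x + t *: d.
have yx : y - x = t *: d by rewrite /y addrAC subrr add0r.
have yb : ball xs r y by apply: r2P; rewrite yx.
have := r1P y; rewrite yx => /(_ t1) h.
have := dual_normP (t *: d) (dual_elt_remainder y fd Hx).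
move=> /le_trans/(_ (ler_wpM2r (normr_ge0 _) h)) /ler_normlP[_].
have g1 := convex_gradient fd cvx xb yb.
have g2 := convex_gradient fd cvx yb xb.
have dN : 'd f y (x - y) = - 'd f y (t *: d) by rewrite -linearN -yx opprB.
rewrite dN yx in g1 g2.
rewrite /derivative_remainder yx (symmetric_operatorZl _ _ _ Hx).
case: (Hx) => Hd _ _ _; rewrite (dual_eltZ (Hd _)) normrZ gtr0_norm// => h3.
have t20 : 0 < t ^+ 2 by rewrite exprn_gt0.
rewrite -(ler_pM2l t20); lra.
Qed.

Lemma is_derive_first_order (phi : R -> R) t l :
  (forall e : R, 0 < e -> exists2 d : R, 0 < d & forall s, `|s| < d ->
    `|phi (t + s) - phi t - s * l| <= e * `|s|) ->
  is_derive t 1 phi l.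
Proof.
move=> h.
have cv : h^-1 *: (phi (h *: 1 + t) - phi t) @[h --> 0^'] --> l.
  apply/cvgrPdist_le => e e0; have [d d0 dP] := h _ e0.
  exists d => //= s /=; rewrite sub0r normrN => sd s0.
  rewrite -(ler_pM2l (_ : 0 < `|s|)) ?normr_gt0// -normrM [_ * e]mulrC.
  apply: le_trans (dP _ sd); rewrite -normrN /GRing.scale /= mulr1 [s + t]addrC.
  by rewrite le_eqVlt; apply/orP; left; apply/eqP; congr Num.norm; field.
by apply: DeriveDef; [exact: cvgP cv|exact: cvg_lim cv].
Qed.

(** Mean value theorem for [fun t => 'd f (x + t *: (y - x)) v], whose derivative at
    [t] is [H (x + t *: (y - x)) (y - x) v]. *)
Lemma remainder_le_of_oscillation f H (x y : V) (e : R) : (forall x, differentiable f x) ->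
  (forall x, symmetric_bounded_operator (H x)) ->
  (forall t, 0 <= t <= 1 -> is_hessian f H (x + t *: (y - x)) /\
    forall d, dual_norm (fun v => H (x + t *: (y - x)) d v - H x d v) <= e * `|d|) ->
  dual_norm (derivative_remainder f H x y) <= e * `|x - y|.
Proof.
move=> fd Hs hyp.
have e0 : 0 <= e * `|x - y|.
  have [|_ /(_ (x - y))] := hyp 0; first by rewrite lexx ler01.
  apply: le_trans; apply: dual_norm_ge0.
  have [H1 _ _ _] := Hs (x + 0 *: (y - x)); have [H2 _ _ _] := Hs x.
  exact: dual_elt_sub (H1 _) (H2 _).
apply: dual_norm_le => // v.
pose phi (t : R) : R := 'd f (x + t *: (y - x)) v.
have dphi (t : R) : 0 <= t <= 1 -> is_derive t (1 : R) phi (H (x + t *: (y - x)) (y - x) v).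
  move=> t01; have [hess _] := hyp _ t01; set z := x + t *: (y - x) in hess *.
  apply: is_derive_first_order => a a0.
  have n0 : 0 < `|y - x| * `|v| + 1 by rewrite ltr_wpDl ?mulr_ge0.
  have [d d0 dP] := nearP_norm (hess _ (divr_gt0 a0 n0)).
  exists (d / (`|y - x| + 1)); first by rewrite divr_gt0 ?ltr_wpDl.
  move=> s sd.
  have zE : x + (t + s) *: (y - x) = z + s *: (y - x) by rewrite scalerDl addrA.
  have zz : z + s *: (y - x) - z = s *: (y - x) by rewrite addrAC subrr add0r.
  have sd' : `|s *: (y - x)| < d.
    rewrite normrZ; move: sd; rewrite ltr_pdivlMr ?ltr_wpDl//; apply: le_lt_trans.
    by rewrite ler_wpM2l// lerDl.
  have := dP (z + s *: (y - x)); rewrite zz => /(_ sd') h.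
  have := dual_normP v (dual_elt_remainder (z + s *: (y - x)) fd (Hs z)).
  move=> /le_trans/(_ (ler_wpM2r (normr_ge0 _) h)).
  rewrite /derivative_remainder zz (symmetric_operatorZl _ _ _ (Hs z)) /phi zE => h3.
  apply: le_trans h3 _; rewrite normrZ.
  rewrite [_ * (`|s| * _)]mulrCA -mulrA -mulrA [leRHS]mulrC ler_wpM2l//.
  by rewrite mulrAC ler_pdivrMr// ler_wpM2l ?(ltW a0)// lerDl.
have [||c c01] := @MVT_segment R phi (fun t => H (x + t *: (y - x)) (y - x) v) 0 1 ler01.
- by move=> t; rewrite in_itv /= => /andP[t0 t1]; apply: dphi; rewrite !ltW.
- by apply: derivable_within_continuous => t; rewrite in_itv /= => /dphi [].
rewrite /phi scale1r scale0r addr0 subr0 mulr1 addrCA subrr addr0 => E.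
have [_ /(_ (y - x)) h] := hyp c c01.
have [H1 _ _ _] := Hs (x + c *: (y - x)); have [H2 _ _ _] := Hs x.
have du : dual_elt (fun v => H (x + c *: (y - x)) (y - x) v - H x (y - x) v).
  exact: dual_elt_sub (H1 _) (H2 _).
rewrite /derivative_remainder E [`|x - y|]distrC; apply: le_trans (dual_normP v du) _.
by rewrite ler_wpM2r.
Qed.

(** Near [xs] all the operators [H x] are within [e / 2] of [H xs], hence within [e] of
    each other. *)
Lemma uniform_remainder f H xs r : (forall x, differentiable f x) ->
  (forall x, symmetric_bounded_operator (H x)) -> 0 < r ->
  (forall x, ball xs r x -> is_hessian f H x /\ operator_continuous_at H x) ->
  forall e : R, 0 < e -> exists2 rho : R, 0 < rho <= r &
    forall x y, `|x - xs| < rho -> `|y - xs| < rho ->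
    dual_norm (derivative_remainder f H x y) <= e * `|x - y|.
Proof.
move=> fd Hs r0 C2 e e0.
have [_ oc] := C2 _ (ballxx _ r0).
have [d d0 dP] := nearP_norm (oc _ (divr_gt0 e0 (ltr0n _ 2))).
exists (Num.min d r); first by rewrite lt_min d0 r0 ge_min lexx orbT.
move=> x y; rewrite !lt_min => /andP[xd xr] /andP[yd yr].
apply: remainder_le_of_oscillation => // t /andP[t0 t1].
set z := x + t *: (y - x).
have zb (a : R) : `|x - xs| < a -> `|y - xs| < a -> `|z - xs| < a.
  move=> xa ya.
  have -> : z - xs = (1 - t) *: (x - xs) + t *: (y - xs).
    have yxE : y - x = (y - xs) - (x - xs) by rewrite opprB addrA subrK.
    rewrite /z yxE addrAC scalerBr scalerBl scale1r.
    by rewrite [t *: (y - xs) - _]addrC addrA.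
  apply: le_lt_trans (ler_normD _ _) _.
  rewrite !normrZ (ger0_norm t0) ger0_norm ?subr_ge0//.
  have [->|t0'] := eqVneq t 0; first by rewrite mul0r subr0 mul1r addr0.
  have t00 : 0 < t by rewrite lt_neqAle eq_sym t0'.
  rewrite -(ltr_pM2l t00) in ya.
  have : (1 - t) * `|x - xs| <= (1 - t) * a by rewrite ler_wpM2l ?subr_ge0// ltW.
  lra.
split.
  by have [] := C2 z _ => //; rewrite -ball_normE /= distrC; exact: zb.
move=> v.
have du a b : dual_elt (fun w => H a v w - H b v w).
  have [Ha _ _ _] := Hs a; have [Hb _ _ _] := Hs b.
  exact: dual_elt_sub (Ha _) (Hb _).
apply: dual_norm_le; first by rewrite mulr_ge0 // ltW.
move=> w.
have hz := le_trans (dual_normP w (du z xs)) (ler_wpM2r (normr_ge0 w) (dP z (zb _ xd yd) v)).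
have hx := le_trans (dual_normP w (du x xs)) (ler_wpM2r (normr_ge0 w) (dP x xd v)).
have -> : H z v w - H x v w = (H z v w - H xs v w) - (H x v w - H xs v w) by ring.
apply: le_trans (ler_normB _ _) _; lra.
Qed.

End Local.

(** * One regularised Newton step *)

Section Step.
Context {R : realType} {V : completeNormedModType R}.
Variables (ip : {dot V for idfun}) (f : V -> R^o) (psi : V -> \bar R)
  (H : V -> V -> V -> R).
Hypotheses (ipn : hilbert_norm ip) (fd : forall x, differentiable f x)
  (psiP : proper_function psi) (psi_cvx : econvex_on setT psi)
  (psi_lsc : lower_semicontinuous psi)
  (Hs : forall x, symmetric_bounded_operator (H x)).

Local Notation F := (objective f psi).

Lemma edomP x : edom F x <-> psi x \is a fin_num.
Proof.
rewrite /edom /objective /=; have := psiP.1 x.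
by case: (psi x) => [r| |]//= _; split=> //; rewrite ltry.
Qed.

Lemma fineF x : edom F x -> F x = (f x + fine (psi x))%:E.
Proof. by move=> /edomP px; rewrite EFinD fineK. Qed.

Lemma subdifferential_fin z p : subdifferential psi z p -> psi z \is a fin_num.
Proof.
move=> [_ ps]; have [ppsi [y0 y0fin]] := psiP.
move: (ps y0) (ppsi y0) (ppsi z) y0fin.
by case: (psi z) => [r| |]; case: (psi y0).
Qed.

Lemma subdifferential_le z y p : subdifferential psi z p -> psi y \is a fin_num ->
  fine (psi z) + p (y - z) <= fine (psi y).
Proof.
move=> sub py; have pz := subdifferential_fin sub.
by rewrite -lee_fin EFinD !fineK//; exact: sub.2.
Qed.

Lemma subdifferential_monotone x y p q : subdifferential psi x p ->
  subdifferential psi y q -> p (y - x) <= q (y - x).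
Proof.
move=> px qy.
have := subdifferential_le px (subdifferential_fin qy).
have := subdifferential_le qy (subdifferential_fin px).
have -> : x - y = - (y - x) by rewrite opprB.
by rewrite (dual_eltN qy.1); lra.
Qed.

Section OneStep.
Variables (lam : R) (x : V).
Hypothesis (lam0 : 0 < lam).

Lemma dual_elt_psi_step xp : dual_elt (psi_step ip f H lam x xp).
Proof.
have [Hd _ _ _] := Hs x.
have := dual_elt_comb (- lam) (dual_elt_sub (dual_elt_opp (dual_elt_diff (fd x))) (Hd (xp - x)))
  (dual_elt_ip ipn (xp - x)).
by congr dual_elt; apply/funext => d; rewrite mulNr.
Qed.

Lemma F_stepE xp d : F_step ip f H lam x xp d =
  derivative_remainder f H x xp d - lam * ip (xp - x) d.
Proof. by rewrite /F_step /psi_step /derivative_remainder /riesz; lra. Qed.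

Lemma F_step_sub xp : subdifferential psi xp (psi_step ip f H lam x xp) ->
  objective_subdifferential f psi xp (F_step ip f H lam x xp).
Proof. by exists (psi_step ip f H lam x xp). Qed.

Lemma dual_elt_objective_subdifferential z g :
  objective_subdifferential f psi z g -> dual_elt g.
Proof.
by move=> [p [pd _] <-]; exact: dual_elt_add (dual_elt_diff (fd z)) pd.
Qed.

(** Monotonicity of the subdifferential between [x] and [xp] gives
    [lam * |xp - x|^2 + H x (xp - x) (xp - x) <= - g (xp - x)]. This controls every trial
    point, accepted or not. *)
Lemma admissible_step_le xp g : (forall d, 0 <= H x d d) ->
  objective_subdifferential f psi x g -> admissible ip f psi H lam x xp ->
  lam * `|xp - x| <= dual_norm g.
Proof.
move=> H0 gx [sub _].
have gd := dual_elt_objective_subdifferential gx.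
have [p px gE] := gx.
have := subdifferential_monotone px sub; rewrite /psi_step /riesz ipn => mono.
have := dual_normP (xp - x) gd; rewrite ler_norml => /andP[+ _].
rewrite -gE => h; have := H0 (xp - x) => h0.
have [->|xpx] := eqVneq (xp - x) 0; first by rewrite normr0 mulr0 dual_norm_ge0// gE.
rewrite -gE in gd *.
have n0 : 0 < `|xp - x| by rewrite normr_gt0.
rewrite -(ler_pM2r n0); lra.
Qed.

(** The model is a strongly convex quadratic plus [psi], since [H x] is nonnegative and
    [lam] is positive. *)
Lemma exists_admissible z0 p : subdifferential psi z0 p ->
  edom F x -> (forall d, 0 <= H x d d) ->
  exists xp, admissible ip f psi H lam x xp.
Proof.
move=> sub0 xdom H0.
have [Hd _ Hsym _] := Hs x.
pose B d e := H x d e + lam * ip d e.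
have Bd d : dual_elt (B d) := dual_elt_comb lam (Hd d) (dual_elt_ip ipn d).
have Bsym d e : B d e = B e d by rewrite /B Hsym ipC.
have Blam d : lam * `|d| ^+ 2 <= B d d by rewrite /B ipn lerDr.
pose g d := 'd f x d - B x d.
have gd : dual_elt g := dual_elt_sub (dual_elt_diff (fd x)) (Bd x).
have [xp [xps xpmin]] :=
  strongly_convex_minimiser psiP psi_cvx psi_lsc gd Bd Bsym lam0 Blam sub0.
exists xp; split.
  move: xps; congr subdifferential; apply/funext => d.
  by rewrite /psi_step /g /B /riesz [H x (xp - x) d]Hsym (dual_eltB (Hd _)) ipBl !(Hsym d); lra.
have := xpmin x; have xpfin := subdifferential_fin xps.
have /edomP xfin := xdom; rewrite /model -(fineK xpfin) -(fineK xfin) -!EFinD !lee_fin.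
set d := xp - x.
have -> : xp = x + 1 *: d by rewrite line_end.
rewrite (quadratic_lineE gd Bd Bsym) scale1r /g /B !ipn subrr normr0.
rewrite (dual_elt0 (dual_elt_diff (fd x))) (dual_elt0 (Hd _)).
lra.
Qed.

(** [F'(xp)] is the remainder [r] minus [lam] times the Riesz image of [d = xp - x]. For
    the gradient test, after expanding [|F'(xp)|^2] and bounding [alpha] by [1 / 2], it
    is enough that [|r| <= lam * |d|]. For the descent test, the subgradient inequalities
    of [f] and [psi] at [xp] bound the decrease below by
    [lam * |d|^2 - r d >= lam / 2 * |d|^2]. *)
Lemma accepted_of_small_remainder alpha beta e xp :
  0 < alpha <= 1 / 2 -> beta <= 1 / 2 -> edom F x ->
  admissible ip f psi H lam x xp ->
  f xp + 'd f xp (x - xp) <= f x ->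
  dual_norm (derivative_remainder f H x xp) <= e * `|xp - x| ->
  2 * e <= lam ->
  accepted ip f psi H alpha beta lam x xp.
Proof.
move=> /andP[a0 a2] b2 xdom [sub _] grad rem elam.
have rd := dual_elt_remainder xp fd (Hs x).
have r0 := dual_norm_ge0 rd.
have lam0' := lam0.
set d := xp - x in rem.
have dN : x - xp = - d by rewrite opprB.
have rP : `|derivative_remainder f H x xp d| <= e * `|d| ^+ 2.
  apply: le_trans (dual_normP d rd) _; rewrite expr2 mulrA ler_wpM2r//.
have FE : F_step ip f H lam x xp (x - xp) =
    lam * `|d| ^+ 2 - derivative_remainder f H x xp d.
  by rewrite dN F_stepE (dual_eltN rd) (dual_eltN (dual_elt_ip ipn _)) ipn; lra.
have ed : e * `|d| ^+ 2 <= lam / 2 * `|d| ^+ 2 by rewrite ler_wpM2r ?sqr_ge0//; lra.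
split.
  have -> : dual_norm (F_step ip f H lam x xp) ^+ 2 =
     dual_norm (derivative_remainder f H x xp) ^+ 2
     - 2 * lam * derivative_remainder f H x xp d + lam ^+ 2 * `|d| ^+ 2.
    rewrite -(dual_norm_comb ipn)//; congr (dual_norm _ ^+ 2).
    by apply/funext => v; rewrite F_stepE.
  rewrite FE.
  set r := dual_norm _ in rem r0 *; set s := derivative_remainder _ _ _ _ _ in rP *.
  have rlam : r ^+ 2 <= (lam / 2 * `|d|) ^+ 2.
    rewrite ler_sqr ?nnegrE ?mulr_ge0 ?divr_ge0 ?(ltW lam0)//.
    by apply: le_trans rem _; rewrite ler_wpM2r//; lra.
  have X0 : 0 <= r ^+ 2 - 2 * lam * s + lam ^+ 2 * `|d| ^+ 2.
    have : 2 * lam * s <= 2 * lam * (lam / 2 * `|d| ^+ 2).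
      rewrite ler_wpM2l ?mulr_ge0 ?(ltW lam0)//.
      by move: rP; rewrite ler_norml => /andP[_]; lra.
    by have := sqr_ge0 r; lra.
  rewrite mulrAC ler_pdivrMr//.
  have : alpha * (r ^+ 2 - 2 * lam * s + lam ^+ 2 * `|d| ^+ 2) <=
     1 / 2 * (r ^+ 2 - 2 * lam * s + lam ^+ 2 * `|d| ^+ 2) by rewrite ler_wpM2r.
  have := mulr_ge0 (ltW lam0) (mulr_ge0 (ltW lam0) (sqr_ge0 `|d|)).
  by move: rlam; rewrite exprMn; lra.
have xpfin := subdifferential_fin sub.
have /edomP xfin := xdom.
have := subdifferential_le sub xfin => sube.
rewrite fineF// fineF; last exact/edomP.
rewrite -EFinB lee_fin.
have : beta * (lam * `|d| ^+ 2) <= 1 / 2 * (lam * `|d| ^+ 2).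
  by rewrite ler_wpM2r ?mulr_ge0 ?sqr_ge0 ?(ltW lam0)//.
have : F_step ip f H lam x xp (x - xp) =
  'd f xp (x - xp) + psi_step ip f H lam x xp (x - xp) by [].
rewrite FE.
by move: rP; rewrite ler_norml => /andP[_]; lra.
Qed.

Lemma accepted_dual_norm alpha beta xp : 0 < alpha ->
  accepted ip f psi H alpha beta lam x xp ->
  alpha * dual_norm (F_step ip f H lam x xp) <= lam * `|xp - x|.
Proof.
move=> a0 [h _].
have Fd : dual_elt (F_step ip f H lam x xp).
  exact: dual_elt_add (dual_elt_diff (fd xp)) (dual_elt_psi_step xp).
have := dual_normP (x - xp) Fd; rewrite ler_norml => /andP[_]; rewrite distrC.
move: h; set N := dual_norm _; set a := F_step _ _ _ _ _ _ _.
have N0 : 0 <= N by apply: dual_norm_ge0.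
have [->|Nn0] := eqVneq N 0; first by rewrite mulr0 mulr_ge0 ?(ltW lam0).
have Np : 0 < N by rewrite lt_neqAle eq_sym Nn0.
move=> h1 h2; have := le_trans h1 h2.
by rewrite mulrAC ler_pdivrMr// -(ler_pM2r Np); lra.
Qed.

End OneStep.

End Step.

(** * Sequences halved down to a threshold *)

Section Scalar.
Context {R : realType}.
Implicit Types (u a lam : nat -> R).

Lemma halving_le_max u (c : R) N : 0 <= c ->
  (forall k, (N <= k)%N -> u k.+1 <= Num.max (u k / 2) c) ->
  forall n, u (N + n)%N <= Num.max (u N / 2 ^+ n) c.
Proof.
move=> c0 h; elim=> [|n IH]; first by rewrite addn0 expr0 divr1 le_max lexx.
rewrite addnS; apply: le_trans (h _ (leq_addr _ _)) _.
rewrite ge_max; apply/andP; split; last by rewrite le_max lexx orbT.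
have : u (N + n)%N / 2 <= Num.max (u N / 2 ^+ n) c / 2 by rewrite ler_pM2r.
move=> /le_trans; apply; rewrite le_max exprS invfM.
case: (leP (u N / 2 ^+ n) c) => hc; last by apply/orP; left; lra.
by apply/orP; right; lra.
Qed.

(** The form in which the parameters decrease: halved unless already below any
    prescribed threshold. *)
Lemma halving_cvg0 u : (forall k, 0 <= u k) ->
  (forall c : R, 0 < c -> exists N, forall k, (N <= k)%N -> u k.+1 <= Num.max (u k / 2) c) ->
  u @ \oo --> 0.
Proof.
move=> u0 h; apply/(@cvg_ooP R R^o) => e e0.
have c0 : 0 < e / 2 by rewrite divr_gt0.
have [N NP] := h _ c0.
have := halving_le_max (ltW c0) NP => uN.
pose n0 := Num.bound (u N / (e / 2)).
exists (N + n0)%N => k Nk; rewrite subr0 ger0_norm//.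
have -> : k = (N + (k - N))%N by rewrite subnKC// (leq_trans _ Nk)// leq_addr.
have kn : (n0 <= k - N)%N by rewrite leq_subRL// (leq_trans _ Nk)// leq_addr.
apply: le_lt_trans (uN _) _; rewrite gt_max; apply/andP; split; last lra.
have p0 : (0 : R) < 2 ^+ (k - N) by rewrite exprn_gt0.
rewrite ltr_pdivrMr//.
have h1 : u N / (e / 2) < n0%:R.
  by apply: archi_boundP; rewrite divr_ge0// ltW.
rewrite ltr_pdivrMr// in h1.
have h2 : (n0%:R : R) <= 2 ^+ (k - N).
  rewrite -natrX ler_nat; apply: leq_trans kn _; apply: ltnW; exact: ltn_expl.
have : n0%:R * (e / 2) <= 2 ^+ (k - N) * (e / 2) by rewrite ler_wpM2r// ltW.
have := mulr_gt0 p0 c0; lra.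
Qed.

End Scalar.

(** * Iterates, regularisation parameters and descent *)

Section Run.
Context {R : realType} {V : completeNormedModType R}.
Variables (ip : {dot V for idfun}) (f : V -> R^o) (psi : V -> \bar R)
  (H : V -> V -> V -> R) (alpha beta Lambda0 : R).
Hypotheses (ipn : hilbert_norm ip) (fd : forall x, differentiable f x)
  (psiP : proper_function psi) (psi_cvx : econvex_on setT psi)
  (psi_lsc : lower_semicontinuous psi)
  (Hs : forall x, symmetric_bounded_operator (H x))
  (alpha12 : 0 < alpha <= 1 / 2) (beta12 : 0 < beta <= 1 / 2)
  (Lambda00 : 0 < Lambda0).

Local Notation F := (objective f psi).

Variables (x : nat -> V) (dF : nat -> V -> R) (lambda : nat -> R).
Hypothesis (run : leap_ssn_run ip f psi H alpha beta Lambda0 x dF lambda).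

Lemma run_lambda_gt0 k : 0 < lambda k.
Proof.
elim: k => [|k IH].
  by have [j [-> _ _ _ _]] := run_step run 0; rewrite mulr_gt0// exprn_gt0.
by have [j [-> _ _ _ _]] := run_step run k.+1; rewrite mulr_gt0 ?exprn_gt0// divr_gt0.
Qed.

Lemma run_lambda_half k : lambda k / 2 <= lambda k.+1.
Proof.
have [j [-> _ _ _ _]] := run_step run k.+1.
by apply: ler_peMl; [rewrite divr_ge0// ltW// run_lambda_gt0|rewrite exprn_ege1// ler1n].
Qed.

Lemma run_admissible k : admissible ip f psi H (lambda k) (x k) (x k.+1).
Proof. by have [j []] := run_step run k. Qed.

Lemma run_accepted k : accepted ip f psi H alpha beta (lambda k) (x k) (x k.+1).
Proof. by have [j []] := run_step run k. Qed.

Lemma run_dFS k : dF k.+1 = F_step ip f H (lambda k) (x k) (x k.+1).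
Proof. by have [j []] := run_step run k. Qed.

Lemma run_edom k : edom F (x k).
Proof.
case: k => [|k]; first exact: run_dom run.
by apply/edomP => //; exact: subdifferential_fin (run_admissible k).1.
Qed.

Lemma run_dF k : objective_subdifferential f psi (x k) (dF k).
Proof.
case: k => [|k]; first exact: run_dF0 run.
by rewrite run_dFS; apply: F_step_sub; exact: (run_admissible k).1.
Qed.

Lemma run_dual_elt k : dual_elt (dF k).
Proof. exact: dual_elt_objective_subdifferential (run_dF k). Qed.

Lemma run_dual_norm k : alpha * dual_norm (dF k.+1) <= lambda k * `|x k.+1 - x k|.
Proof.
rewrite run_dFS; apply: accepted_dual_norm (run_accepted k) => //.
- exact: run_lambda_gt0.
- by case/andP: alpha12.
Qed.

Lemma run_fineF k : F (x k) = (fine (F (x k)))%:E.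
Proof. by rewrite (fineF psiP (run_edom k)). Qed.

Lemma run_decrease k :
  beta * lambda k * `|x k.+1 - x k| ^+ 2 <= fine (F (x k)) - fine (F (x k.+1)).
Proof.
by have [_] := run_accepted k; rewrite run_fineF [F (x k.+1)]run_fineF -EFinB lee_fin.
Qed.

Lemma run_nonincreasing k n : (k <= n)%N -> fine (F (x n)) <= fine (F (x k)).
Proof.
move=> /subnK <-; elim: (n - k)%N => [//|i IH]; rewrite addSn; apply: le_trans IH.
case/andP: beta12 => b0 _; rewrite -subr_ge0; apply: le_trans (run_decrease (i + k)).
by rewrite !mulr_ge0 ?sqr_ge0// ltW// run_lambda_gt0.
Qed.

Section NearLimit.
Variables (xs : V) (r : R).
Hypotheses (hess : forall y, ball xs r y -> is_hessian f H y)
  (f_cvx : convex_function (ball xs r) f).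

Lemma run_hessian_ge0 y d : `|y - xs| < r -> 0 <= H y d d.
Proof.
move=> yr; have yb : ball xs r y by rewrite -ball_normE /= distrC.
exact: (convex_hessian_ge0 d fd (Hs y) f_cvx yb (hess yb)).
Qed.

(** Either the first trial value [lambda k / 2] is accepted, or [lambda k.+1 / 2] is a
    trial value that failed. In the second case the trial point is within
    [2 / alpha * |x k.+1 - x k|] of [x k.+1], where the remainder is small, so that a
    failure is possible only below [2 * e]. *)
Lemma run_lambda_le (rho e : R) k : rho <= r -> 0 <= e ->
  (forall y z, `|y - xs| < rho -> `|z - xs| < rho ->
    dual_norm (derivative_remainder f H y z) <= e * `|y - z|) ->
  `|x k.+1 - xs| + 2 / alpha * `|x k.+1 - x k| < rho ->
  lambda k.+1 <= Num.max (lambda k / 2) (4 * e).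
Proof.
move=> rhor e0 rem close.
have /andP[a0 a12] := alpha12; have /andP[b0 b12] := beta12.
have lk := run_lambda_gt0 k.
have pos2 : 0 <= 2 / alpha * `|x k.+1 - x k| by rewrite mulr_ge0 ?divr_ge0 ?(ltW a0).
have xk_rho : `|x k.+1 - xs| < rho by lra.
have H0 d : 0 <= H (x k.+1) d d by apply: run_hessian_ge0; exact: lt_le_trans xk_rho rhor.
have [[|i] [lamE fails _ _ _]] := run_step run k.+1.
  by rewrite lamE expr0 mul1r /= le_max lexx.
rewrite le_max; apply/orP; right.
have := fails i (ltnSn i); move: lamE => /=; rewrite exprS -mulrA.
set mu := 2 ^+ i * _ => lamE trial.
have mu_ge : lambda k / 2 <= mu.
  by apply: ler_peMl; [rewrite divr_ge0// ltW|rewrite exprn_ege1// ler1n].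
have mu0 : 0 < mu by apply: lt_le_trans mu_ge; rewrite divr_gt0.
suff : mu <= 2 * e by rewrite lamE; lra.
rewrite leNgt; apply/negP => emu.
have [p p_sub _] := run_dF k.+1.
case: trial => [|[xp [adm]]]; apply.
  exact: (exists_admissible ipn fd psiP psi_cvx psi_lsc Hs mu0 p_sub (run_edom _) H0).
have step := admissible_step_le ipn fd psiP H0 (run_dF k.+1) adm.
have xp_step : `|xp - x k.+1| <= 2 / alpha * `|x k.+1 - x k|.
  have h1 : lambda k / 2 * `|xp - x k.+1| <= dual_norm (dF k.+1).
    by apply: le_trans step; rewrite ler_wpM2r.
  have := run_dual_norm k; rewrite -(ler_pM2l a0) in h1.
  move=> /(le_trans h1) h2.
  rewrite mulrAC ler_pdivlMr// -(ler_pM2l lk); lra.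
have xp_rho : `|xp - xs| < rho.
  by apply: le_lt_trans (ler_distD (x k.+1) _ _) _; lra.
have inball y : `|y - xs| < rho -> ball xs r y.
  by move=> yr; rewrite -ball_normE /= distrC; exact: lt_le_trans rhor.
apply: (accepted_of_small_remainder ipn fd psiP Hs mu0 _ _ _ adm _ _ (ltW emu)) => //.
- exact: run_edom.
- by apply: (convex_gradient fd f_cvx); exact: inball.
- by rewrite distrC; exact: rem.
Qed.

Hypothesis (r0 : 0 < r) (hcont : forall y, ball xs r y -> operator_continuous_at H y).

(** Along a convergent run the steps vanish, so the closeness required by
    [run_lambda_le] eventually holds for every [e]. *)
Lemma run_lambda_cvg0 : x @ \oo --> xs -> lambda @ \oo --> (0 : R).
Proof.
move=> xxs; apply: halving_cvg0 => [k|c c0]; first exact/ltW/run_lambda_gt0.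
have /andP[a0 a12] := alpha12.
have e0 : 0 < c / 4 by rewrite divr_gt0.
have C2 y : ball xs r y -> is_hessian f H y /\ operator_continuous_at H y.
  by move=> yb; split; [exact: hess|exact: hcont].
have [rho /andP[rho0 rhor] rem] := uniform_remainder fd Hs r0 C2 e0.
have t0 : 0 < 1 + 4 / alpha by rewrite addr_gt0 ?divr_gt0.
have [N NP] := (cvg_ooP x xs).1 xxs _ (divr_gt0 rho0 t0).
exists N => k Nk; have -> : c = 4 * (c / 4) by lra.
apply: (run_lambda_le rhor (ltW e0) rem).
have h1 := NP k.+1 (leqW Nk); have h2 := NP k Nk.
have h3 : `|x k.+1 - x k| < 2 * (rho / (1 + 4 / alpha)).
  by apply: le_lt_trans (dist_le_add_dist xs _ _) _; lra.
have h4 : 2 / alpha * `|x k.+1 - x k| < 2 / alpha * (2 * (rho / (1 + 4 / alpha))).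
  by rewrite ltr_pM2l// divr_gt0.
have : rho / (1 + 4 / alpha) + 2 / alpha * (2 * (rho / (1 + 4 / alpha))) = rho.
  by field; rewrite !gt_eqF//; lra.
lra.
Qed.

End NearLimit.
End Run.

(** * Rates for real sequences *)

Section ScalarRates.
Context {R : realType}.
Implicit Types (a G lam : nat -> R).

Lemma cvg0_le lam (e : R) : lam @ \oo --> (0 : R) -> 0 < e ->
  exists N, forall k, (N <= k)%N -> lam k <= e.
Proof.
move=> /(@cvg_ooP R R^o) h /h[N NP]; exists N => k /NP; rewrite subr0 => /ltW.
by apply: le_trans; exact: ler_norm.
Qed.

Lemma cvg0_const_mul lam (c : R) : lam @ \oo --> (0 : R) ->
  (fun k => c * lam k) @ \oo --> (0 : R).
Proof.
by move=> h; rewrite -(mulr0 c); apply: cvgM; [exact: cvg_cst|exact: h].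
Qed.

Lemma cvg0_sqrt lam : lam @ \oo --> (0 : R) -> (fun k => Num.sqrt (lam k)) @ \oo --> (0 : R).
Proof.
move=> h; rewrite -sqrtr0.
by apply: (@continuous_cvg _ _ _ _ _ lam Num.sqrt) => //; exact: sqrt_continuous.
Qed.

Lemma bigmin_ge0 G k : (forall i, 0 <= G i) ->
  0 <= \big[Num.min/G 1%N]_(0 <= j < k) G j.+1.
Proof. by move=> G0; elim/big_ind: _ => // a b a0 b0; rewrite le_min a0. Qed.

(** Summing the decrease inequality over the second half of the indices, where [lam]
    is below a small [eps], bounds [k / 2] times the squared minimum by a constant
    times [eps]. *)
Lemma bigmin_rate G a lam (C amin e : R) : 0 < C ->
  (forall k, 0 <= G k) -> (forall k, 0 <= lam k) ->
  (forall k, a k.+1 <= a k) -> (forall k, amin <= a k) ->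
  (forall k, G k.+1 ^+ 2 <= C * lam k * (a k - a k.+1)) ->
  lam @ \oo --> (0 : R) -> 0 < e ->
  exists N, forall k, (N <= k)%N ->
    \big[Num.min/G 1%N]_(0 <= j < k) G j.+1 <= e / Num.sqrt k%:R.
Proof.
move=> C0 G0 lam0 a_dec a_min step lamc e0.
have a_le n : a n <= a 0%N by elim: n => // n; exact: le_trans.
have A0 : 0 <= a 0%N - amin by rewrite subr_ge0.
have D0 : 0 < 2 * C * (a 0%N - amin + 1) by rewrite !mulr_gt0// ltr_wpDl.
have [N NP] := cvg0_le lamc (divr_gt0 (exprn_gt0 2 e0) D0).
set eps := e ^+ 2 / _ in NP.
have epsE : eps * (2 * C * (a 0%N - amin + 1)) = e ^+ 2 by rewrite /eps mulfVK// gt_eqF.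
have eps0 : 0 < eps by rewrite divr_gt0// exprn_gt0.
exists (2 * N).+1 => k Nk.
set mn := \big[_/_]_(_ <= _ < _) _.
have mn0 : 0 <= mn by apply: bigmin_ge0.
have acc n : (N + n <= k)%N -> n%:R * mn ^+ 2 <= C * eps * (a N - a (N + n)%N).
  elim: n => [|n IH] nk; first by rewrite addn0 subrr mulr0 mul0r.
  have h1 := IH (leq_trans (leq_addr 1 _) (_ : N + n + 1 <= k)%N).
  have : mn ^+ 2 <= G (N + n).+1 ^+ 2.
    by rewrite ler_sqr ?nnegrE//; apply: ge_bigmin_seq => //; rewrite mem_index_iota -addnS.
  move=> /le_trans/(_ (step _)) h2.
  have h3 : C * lam (N + n)%N * (a (N + n)%N - a (N + n).+1) <=
      C * eps * (a (N + n)%N - a (N + n).+1).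
    by rewrite ler_wpM2r ?subr_ge0// ler_wpM2l ?(ltW C0)// NP// leq_addr.
  have {}h1 : n%:R * mn ^+ 2 <= C * eps * (a N - a (N + n)%N).
    by apply: h1; rewrite addn1 -addnS.
  rewrite addnS -natr1; lra.
have Nk' : (N <= k)%N by rewrite (leq_trans _ Nk)// mul2n -addnn -addnS leq_addr.
have := acc (k - N)%N; rewrite subnKC// => /(_ (leqnn _)) h.
have k0 : (0 : R) < k%:R by rewrite ltr0n (leq_trans _ Nk).
have kN : k%:R / 2 <= (k - N)%:R :> R.
  rewrite natrB//; have : (2 * N)%:R <= k%:R :> R by rewrite ler_nat ltnW.
  rewrite natrM; lra.
rewrite ler_pdivlMr ?sqrtr_gt0//.
rewrite -ler_sqr ?nnegrE ?mulr_ge0 ?sqrtr_ge0 ?(ltW e0)//.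
rewrite exprMn sqr_sqrtr ?(ltW k0)//.
have h4 : k%:R / 2 * mn ^+ 2 <= (k - N)%:R * mn ^+ 2 by rewrite ler_wpM2r ?sqr_ge0.
have h5 : C * eps * (a N - a k) <= C * eps * (a 0%N - amin + 1).
  rewrite ler_wpM2l//; first by rewrite mulr_ge0 ?(ltW C0) ?(ltW eps0).
  by have := a_le N; have := a_min k; lra.
rewrite -epsE; lra.
Qed.

(** Once [a k.+1 ^+ 2 <= c * (a k - a k.+1)] and [a N <= 2 * c], the bound
    [n * a (N + n) <= 2 * c] propagates by induction on [n]; [c] is arbitrarily small. *)
Lemma quadratic_decrease_rate a lam (C e : R) : 0 < C ->
  (forall k, 0 <= a k) -> (forall k, a k.+1 <= a k) ->
  (forall k, a k.+1 ^+ 2 <= C * lam k * (a k - a k.+1)) ->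
  lam @ \oo --> (0 : R) -> 0 < e ->
  exists N, forall k, (N <= k)%N -> k%:R * a k <= e.
Proof.
move=> C0 a0 a_dec step lamc e0.
have a_le m n : (m <= n)%N -> a n <= a m.
  by move=> /subnK <-; elim: (n - m)%N => // i; rewrite addSn; exact: le_trans.
have tail (c : R) : 0 < c -> exists N, forall k, (N <= k)%N ->
    a k.+1 ^+ 2 <= c * (a k - a k.+1).
  move=> c0; have [N NP] := cvg0_le lamc (divr_gt0 c0 C0); exists N => k /NP h.
  apply: le_trans (step k) _; rewrite ler_wpM2r ?subr_ge0//.
  by move: h; rewrite ler_pdivlMr// mulrC.
have [c c0 eE] : exists2 c : R, 0 < c & e = 4 * c.
  by exists (e / 4); [rewrite divr_gt0|lra].
have [N1 N1P] := tail _ c0.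
have [N2 N2P] : exists N, a N <= 2 * c.
  have q0 : 0 < (2 * c) ^+ 2 / (a 0%N + 1) by rewrite divr_gt0 ?exprn_gt0 ?mulr_gt0// ltr_wpDl.
  have [N NP] := tail _ q0; exists N.+1.
  rewrite -ler_sqr ?nnegrE// ?mulr_ge0 ?(ltW c0)//.
  apply: le_trans (NP N (leqnn N)) _; rewrite mulrAC ler_pdivrMr ?ltr_wpDl//.
  by rewrite ler_wpM2l ?sqr_ge0//; have := a_le 0 N isT; have := a0 N.+1; lra.
pose N := maxn N1 N2.
(* if the bound failed at [n.+2], then [2 * c - n.+1 * b < b], the decrease inequality
   would give [n.+1 * b < c], and hence [n.+2 * b < 2 * c] *)
have key n : n%:R * a (N + n)%N <= 2 * c.
  elim: n => [|n IH]; first by rewrite mul0r mulr_ge0// ltW.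
  have := N1P (N + n)%N (leq_trans (leq_maxl _ _) (leq_addr _ _)).
  rewrite addnS; set b := a (N + n).+1 => h.
  have bN : b <= 2 * c.
    apply: le_trans N2P; apply: a_le.
    by rewrite ltnW// ltnS (leq_trans (leq_maxr N1 N2))// leq_addr.
  case: n IH @b h bN => [_ b _ bN|n IH b h bN]; first by rewrite mul1r.
  have b0 : 0 <= b by apply: a0.
  rewrite leNgt; apply/negP => big.
  set m : R := n.+1%:R in IH.
  have m1 : 1 <= m by rewrite ler1n.
  have mE : n.+2%:R = m + 1 by rewrite -natr1.
  rewrite mE in big.
  have h2 : m * b ^+ 2 <= c * (2 * c - m * b).
    have : m * b ^+ 2 <= m * (c * (a (N + n.+1)%N - b)) by rewrite ler_wpM2l//; lra.
    have : c * (m * a (N + n.+1)%N) <= c * (2 * c) by rewrite ler_wpM2l// ltW.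
    lra.
  have h3 : c * (2 * c - m * b) < c * b by rewrite ltr_pM2l//; lra.
  have bp : 0 < b.
    rewrite lt_neqAle b0 andbT eq_sym; apply/negP => /eqP bz.
    by move: big; rewrite bz mulr0; lra.
  have : m * b < c.
    by rewrite -(ltr_pM2r bp); lra.
  have := ler_wpM2r b0 m1; lra.
exists (2 * N)%N => k Nk.
have Nk' : (N <= k)%N by rewrite (leq_trans _ Nk)// leq_pmull.
have := key (k - N)%N; rewrite subnKC//.
have kN : k%:R / 2 <= (k - N)%:R :> R.
  rewrite natrB//; have : (2 * N)%:R <= k%:R :> R by rewrite ler_nat.
  rewrite natrM; lra.
have : k%:R / 2 * a k <= (k - N)%:R * a k by rewrite ler_wpM2r.
rewrite eE; lra.
Qed.

End ScalarRates.

Section StepRates.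
Context {R : realType} {V : normedModType R}.

(** When each step is at most half the previous one, the remaining path has length at
    most twice its first step. So the distance of [x k.+1] to the limit is at most
    [2 * delta k] times the step from [x k], itself at most the sum of the distances of
    [x k] and [x k.+1] to the limit. *)
Lemma superlinear_of_steps (x : nat -> V) (xs : V) (delta : nat -> R) :
  x @ \oo --> xs -> (forall k, 0 <= delta k) -> delta @ \oo --> (0 : R) ->
  (exists N, forall k, (N <= k)%N ->
    `|x k.+2 - x k.+1| <= delta k * `|x k.+1 - x k|) ->
  superlinear (fun k => `|x k - xs|).
Proof.
move=> xxs delta0 dc [N0 stepP].
have q0 : 0 < (4^-1 : R) by rewrite invr_gt0.
have [N1 N1P] := cvg0_le dc q0.
exists (fun k => 4 * delta k); split; first exact: cvg0_const_mul.
apply/near_ooP; exists (maxn N0 N1) => k; rewrite geq_max => /andP[k0 k1].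
pose D i := `|x i.+1 - x i|.
have D0 i : 0 <= D i by apply: normr_ge0.
have half i : (k <= i)%N -> D i.+1 <= D i / 2.
  move=> ki; apply: le_trans (stepP _ (leq_trans k0 ki)) _.
  have : delta i * D i <= 4^-1 * D i by rewrite ler_wpM2r// N1P// (leq_trans k1).
  by have := D0 i; rewrite /D; lra.
have tel n : `|x k.+1 - x (k.+1 + n)%N| <= 2 * (D k.+1 - D (k.+1 + n)%N).
  elim: n => [|n IH]; first by rewrite addn0 !subrr normr0 mulr0.
  apply: le_trans (dist_le_add_dist (x (k.+1 + n)%N) _ _) _; rewrite addnS -/(D _).
  have := half (k.+1 + n)%N (leqW (leq_addr _ _)); lra.
have lim_le : `|x k.+1 - xs| <= 2 * D k.+1.
  apply/ler_addgt0Pr => e e0.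
  have [M MP] := (cvg_ooP x xs).1 xxs _ e0.
  have := MP (k.+1 + M)%N (leq_addl _ _) => h.
  apply: le_trans (ler_distD (x (k.+1 + M)%N) _ _) _.
  by have := tel M; have := D0 (k.+1 + M)%N; lra.
have Dk : D k <= `|x k.+1 - xs| + `|x k - xs|.
  exact: dist_le_add_dist.
have s := stepP k k0; rewrite -/(D _) -/(D _) in s.
have h1 : delta k * D k <= delta k * (`|x k.+1 - xs| + `|x k - xs|) by rewrite ler_wpM2l.
have h2 : delta k * `|x k.+1 - xs| <= 4^-1 * `|x k.+1 - xs| by rewrite ler_wpM2r// N1P.
lra.
Qed.

End StepRates.

(** * Subgradients of the objective *)

Section Objective.
Context {R : realType} {V : completeNormedModType R}.
Variables (f : V -> R^o) (psi : V -> \bar R).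
Hypotheses (fd : forall x, differentiable f x) (psiP : proper_function psi).

Local Notation F := (objective f psi).

Lemma PL_dual_norm y g (mu v : R) : 0 < mu ->
  edom F y -> objective_subdifferential f psi y g ->
  (F y - v%:E <= ((2 * mu)^-1)%:E * subdifferential_dist f psi y ^+ 2)%E ->
  2 * mu * (fine (F y) - v) <= dual_norm g ^+ 2.
Proof.
move=> mu0 ydom gy; rewrite (fineF psiP ydom) -EFinB /=.
have dist_ge0 : (0 <= subdifferential_dist f psi y)%E.
  apply: le_ereal_inf_tmp => _ [h hy <-]; rewrite lee_fin dual_norm_ge0//.
  exact (dual_elt_objective_subdifferential fd hy).
have : (subdifferential_dist f psi y <= (dual_norm g)%:E)%E.
  by apply: ereal_inf_lbound; exists g.
case: (subdifferential_dist f psi y) dist_ge0 => [s| |]//.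
rewrite !lee_fin => s0 sg h.
have m0 : 0 < 2 * mu by rewrite mulr_gt0.
have {}h : 2 * mu * (f y + fine (psi y) - v) <= s ^+ 2 by rewrite -ler_pdivlMl.
apply: le_trans h _.
by rewrite ler_sqr// nnegrE// (le_trans s0).
Qed.

(** A first-order expansion of [f] and the subgradient of [psi] bound [F] below near
    [x]; convexity of [F] along the segment from [x] to [u] carries the bound to [u]. *)
Lemma objective_subgradient_le (A : set V) x u g : econvex_on A F ->
  A x -> A u -> edom F x -> edom F u -> objective_subdifferential f psi x g ->
  fine (F x) + g (u - x) <= fine (F u).
Proof.
move=> cvx Ax Au xdom udom gx; have [p px gE] := gx; rewrite -gE.
have fx := dual_elt_diff (fd x).
rewrite (fineF psiP xdom) (fineF psiP udom) /=.
apply: (le_of_vanishing_slope (normr_ge0 (u - x))) => e.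
move=> e0; have [d d0 dP] := diff_first_order (fd x) e0.
have [t t01 td] := small_multiple (u - x) d0.
have /andP[t0 t1] := t01.
have := dP _ td; rewrite (dual_eltZ fx) normrZ gtr0_norm// => /ler_normlP[h _].
have t01' : 0 <= t <= 1 by rewrite ltW.
have := cvx _ _ _ Au Ax t01'.
rewrite convex_comb_line (fineF psiP xdom) (fineF psiP udom) -!EFinM -EFinD => cvxt.
have zdom : edom F (x + t *: (u - x))%R by apply: le_lt_trans cvxt _; rewrite ltry.
have /(edomP _ psiP) zfin := zdom.
have := subdifferential_le psiP px zfin.
rewrite addrAC subrr add0r (dual_eltZ px.1) => h2.
move: cvxt; rewrite (fineF psiP zdom) lee_fin => h3.
rewrite -(ler_pM2l t0); lra.
Qed.

Lemma lsc_objective_limit (x : nat -> V) xs (a : nat -> R) l :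
  lower_semicontinuous psi -> x @ \oo --> xs -> a @ \oo --> l ->
  (forall k, F (x k) = (a k)%:E) -> (F xs <= l%:E)%E.
Proof.
move=> lsc xxs al Fx.
have fx : f (x k) @[k --> \oo] --> f xs.
  by apply: continuous_cvg => //; exact: differentiable_continuous.
have : (psi xs <= (l - f xs)%:E)%E.
  apply: (lsc_seq lsc xxs (cvgB al fx)) => k.
  by rewrite /= EFinB -(Fx k) /objective addrAC -EFinB subrr add0e.
by rewrite /objective EFinB leeBrDl.
Qed.

End Objective.

(** * Rates of convergence *)

Section RunRates.
Context {R : realType} {V : completeNormedModType R}.
Variables (ip : {dot V for idfun}) (f : V -> R^o) (psi : V -> \bar R)
  (H : V -> V -> V -> R) (alpha beta Lambda0 : R).
Hypotheses (ipn : hilbert_norm ip) (fd : forall x, differentiable f x)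
  (psiP : proper_function psi) (psi_cvx : econvex_on setT psi)
  (psi_lsc : lower_semicontinuous psi)
  (Hs : forall x, symmetric_bounded_operator (H x))
  (alpha12 : 0 < alpha <= 1 / 2) (beta12 : 0 < beta <= 1 / 2)
  (Lambda00 : 0 < Lambda0).

Local Notation F := (objective f psi).

Variables (x : nat -> V) (dF : nat -> V -> R) (lambda : nat -> R).
Hypothesis (run : leap_ssn_run ip f psi H alpha beta Lambda0 x dF lambda).

Let lambda_gt0 k : 0 < lambda k := run_lambda_gt0 Lambda00 run k.

Lemma run_dual_norm_sqr k :
  dual_norm (dF k.+1) ^+ 2 <= (alpha ^+ 2)^-1 * (lambda k * `|x k.+1 - x k|) ^+ 2.
Proof.
have /andP[a0 _] := alpha12.
have a20 : 0 < alpha ^+ 2 by rewrite exprn_gt0.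
rewrite ler_pdivlMl// -exprMn ler_sqr ?nnegrE.
- exact: run_dual_norm run k.
- by rewrite mulr_ge0 ?(ltW a0)// dual_norm_ge0//; exact: run_dual_elt run k.+1.
- by rewrite mulr_ge0// ltW.
Qed.

(** The gradient bound squared is [lambda k] times the descent. *)
Lemma run_dual_norm_decrease k :
  dual_norm (dF k.+1) ^+ 2 <=
  (alpha ^+ 2 * beta)^-1 * lambda k * (fine (F (x k)) - fine (F (x k.+1))).
Proof.
have /andP[a0 _] := alpha12; have /andP[b0 _] := beta12.
have a20 : 0 < alpha ^+ 2 by rewrite exprn_gt0.
apply: le_trans (run_dual_norm_sqr k) _.
rewrite (invfM (alpha ^+ 2) beta) -!mulrA ler_pM2l ?invr_gt0// ler_pdivlMl//.
have := run_decrease psiP run k; rewrite -(ler_pM2l (lambda_gt0 k)); lra.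
Qed.

Section VanishingParameter.
Hypothesis lambda_cvg : lambda @ \oo --> (0 : R).
Variable v : R.
Hypothesis v_le : forall k, v <= fine (F (x k)).

Lemma run_min_dual_norm_littleo :
  (fun k => \big[Num.min/dual_norm (dF 1%N)]_(0 <= i < k) dual_norm (dF i.+1) : R^o)
  =o_\oo (fun k => (Num.sqrt k%:R)^-1 : R^o).
Proof.
have /andP[a0 _] := alpha12; have /andP[b0 _] := beta12.
have ab0 : 0 < (alpha ^+ 2 * beta)^-1 by rewrite invr_gt0 mulr_gt0// exprn_gt0.
have G0 i : 0 <= dual_norm (dF i) by apply: dual_norm_ge0; exact (run_dual_elt fd run i).
apply/eqoP => e e0; apply/near_ooP.
have [N NP] := bigmin_rate ab0 G0 (fun k => ltW (lambda_gt0 k))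
  (fun k => run_nonincreasing psiP beta12 Lambda00 run (leqnSn k)) v_le
  run_dual_norm_decrease lambda_cvg e0.
exists N => k /NP h.
rewrite ger0_norm; last exact: (@bigmin_ge0 R (fun k => dual_norm (dF k))).
by rewrite ger0_norm ?invr_ge0 ?sqrtr_ge0.
Qed.

(** The residual at [x k.+1] is at most [dF k.+1 (x k.+1 - u)], hence at most
    a bound on the diameter of [A] times the norm of the gradient. *)
Lemma run_convex_residual_littleo (A : set V) (u : V) (M : R) :
  econvex_on A F -> (forall k, A (x k)) -> A u -> F u = v%:E ->
  (forall y, A y -> `|y| <= M) ->
  (fun k => fine (F (x k)) - v : R^o) =o_\oo (fun k => k%:R^-1 : R^o).
Proof.
move=> F_cvx Ax Au Fu MP.
have /andP[a0 _] := alpha12; have /andP[b0 _] := beta12.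
have udom : edom F u by rewrite /edom /= Fu ltry.
have M0 : 0 <= M by apply: le_trans (MP _ Au).
have ab0 : 0 < (alpha ^+ 2 * beta)^-1 by rewrite invr_gt0 mulr_gt0// exprn_gt0.
have K0 : 0 < (alpha ^+ 2 * beta)^-1 * (2 * M + 1) ^+ 2.
  by rewrite mulr_gt0// exprn_gt0// ltr_wpDl// mulr_ge0.
have quad k : (fine (F (x k.+1)) - v) ^+ 2 <=
    (alpha ^+ 2 * beta)^-1 * (2 * M + 1) ^+ 2 * lambda k *
    ((fine (F (x k)) - v) - (fine (F (x k.+1)) - v)).
  have gd := run_dual_elt fd run k.+1.
  have := objective_subgradient_le fd psiP F_cvx (Ax k.+1) Au (run_edom psiP run _) udom
    (run_dF run k.+1).
  rewrite Fu /= => h.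
  have := dual_normP (u - x k.+1) gd; rewrite ler_norml => /andP[h2 _].
  have h3 : `|u - x k.+1| <= 2 * M + 1.
    apply: le_trans (ler_normB _ _) _.
    by have := MP _ Au; have := MP _ (Ax k.+1); lra.
  have h4 : dual_norm (dF k.+1) * `|u - x k.+1| <= dual_norm (dF k.+1) * (2 * M + 1).
    by rewrite ler_wpM2l// dual_norm_ge0.
  have h5 : fine (F (x k.+1)) - v <= dual_norm (dF k.+1) * (2 * M + 1) by lra.
  have h6 : (fine (F (x k.+1)) - v) ^+ 2 <= (dual_norm (dF k.+1) * (2 * M + 1)) ^+ 2.
    by rewrite ler_sqr ?nnegrE ?subr_ge0 ?v_le// mulr_ge0 ?dual_norm_ge0//; lra.
  apply: le_trans h6 _.
  have M2 : 0 < (2 * M + 1) ^+ 2 by rewrite exprn_gt0//; lra.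
  have := run_dual_norm_decrease k.
  rewrite exprMn -(ler_pM2r M2); lra.
apply/eqoP => e e0; apply/near_ooP.
have v0 k : 0 <= fine (F (x k)) - v by rewrite subr_ge0.
have dec k : fine (F (x k.+1)) - v <= fine (F (x k)) - v.
  by rewrite lerB// (run_nonincreasing psiP beta12 Lambda00 run).
have [N NP] := quadratic_decrease_rate K0 v0 dec quad lambda_cvg e0.
exists N.+1 => k Nk.
have k0 : (0 : R) < k%:R by rewrite ltr0n (leq_trans _ Nk).
rewrite ger0_norm ?subr_ge0// ger0_norm ?invr_ge0 ?(ltW k0)//.
by rewrite ler_pdivlMr// mulrC NP// ltnW.
Qed.

End VanishingParameter.

Section PL.
Variables (mu v : R) (xs : V).
Hypotheses (mu0 : 0 < mu) (v_le : forall k, v <= fine (F (x k)))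
  (PL : forall k, 2 * mu * (fine (F (x k.+1)) - v) <= dual_norm (dF k.+1) ^+ 2).

Let c := (2 * mu * (alpha ^+ 2))^-1.

Let c_gt0 : 0 < c.
Proof.
by have /andP[a0 _] := alpha12; rewrite invr_gt0 !mulr_gt0// exprn_gt0.
Qed.

Lemma run_residual_step k :
  fine (F (x k.+1)) - v <= c * (lambda k * `|x k.+1 - x k|) ^+ 2.
Proof.
have m0 : 0 < 2 * mu by rewrite mulr_gt0.
rewrite /c (invfM (2 * mu)) -mulrA ler_pdivlMl//.
exact: le_trans (PL k) (run_dual_norm_sqr k).
Qed.

Lemma run_residual_decrease k :
  fine (F (x k.+1)) - v <=
  c / beta * lambda k * (fine (F (x k)) - fine (F (x k.+1))).
Proof.
have m0 : 0 < 2 * mu by rewrite mulr_gt0.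
have := le_trans (PL k) (run_dual_norm_decrease k).
rewrite -ler_pdivlMl// => /le_trans; apply.
by rewrite /c (invfM (2 * mu)) (invfM (alpha ^+ 2) beta) !mulrA.
Qed.

Lemma run_residual_superlinear_step k :
  fine (F (x k.+1)) - v <= c / beta * lambda k * (fine (F (x k)) - v).
Proof.
have /andP[b0 _] := beta12.
apply: le_trans (run_residual_decrease k) _; rewrite ler_wpM2l//.
  by rewrite mulr_ge0 ?divr_ge0 ?(ltW c_gt0) ?(ltW b0)// ltW.
by rewrite lerB.
Qed.

Hypotheses (lambda_cvg : lambda @ \oo --> (0 : R)).

Lemma run_residual_superlinear : superlinear (fun k => fine (F (x k)) - v).
Proof.
exists (fun k => c / beta * lambda k); split; first exact: cvg0_const_mul.
by exists 0%N => // k _; exact: run_residual_superlinear_step.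
Qed.

Lemma run_residual_cvg : (fun k => fine (F (x k))) @ \oo --> (v : R).
Proof.
have /andP[b0 _] := beta12.
apply/(@cvg_ooP R R^o) => e e0.
have A0 : 0 < fine (F (x 0%N)) - v + 1 by have := v_le 0; lra.
have [N NP] := cvg0_le (cvg0_const_mul (c / beta) lambda_cvg) (divr_gt0 e0 A0).
exists N.+1 => -[//|k]; rewrite ltnS => Nk.
rewrite ger0_norm ?subr_ge0//.
apply: le_lt_trans (run_residual_superlinear_step k) _.
have h1 : fine (F (x k)) <= fine (F (x 0%N)).
  exact: (run_nonincreasing psiP beta12 Lambda00 run (leq0n k)).
have h2 := v_le k.
have h3 : c / beta * lambda k * (fine (F (x k)) - v) <=
    e / (fine (F (x 0%N)) - v + 1) * (fine (F (x k)) - v).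
  by rewrite ler_wpM2r ?subr_ge0// NP.
apply: le_lt_trans h3 _; rewrite mulrAC ltr_pdivrMr// ltr_pM2l//; lra.
Qed.

(** The residual at [x k.+1] is at most a multiple of [(lambda k * |d_k|)^2] and at least
    [beta * lambda k.+1 * |d_{k+1}|^2]; as [lambda k.+1 >= lambda k / 2], the ratio of
    consecutive steps is at most a multiple of the square root of [lambda k]. *)
Lemma run_iterates_superlinear : x @ \oo --> xs -> superlinear (fun k => `|x k - xs|).
Proof.
move=> xxs; have /andP[b0 _] := beta12.
have c0 := c_gt0.
pose delta k := Num.sqrt (2 * c / beta * lambda k).
apply: (@superlinear_of_steps _ _ x xs delta) => //.
- by move=> k; exact: sqrtr_ge0.
- by apply: cvg0_sqrt; apply: cvg0_const_mul.
- exists 0%N => k _.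
  have q0 : 0 < 2 * c / beta by rewrite divr_gt0// mulr_gt0.
  have l0 := lambda_gt0 k.
  rewrite -ler_sqr ?nnegrE ?mulr_ge0 ?sqrtr_ge0// exprMn sqr_sqrtr; last first.
    by rewrite mulr_ge0 ?ltW.
  have h1 := run_decrease psiP run k.+1.
  have h2 := run_residual_step k.
  have h3 := v_le k.+2.
  have h4 := run_lambda_half Lambda00 run k.
  have h5 : beta * (lambda k / 2) * `|x k.+2 - x k.+1| ^+ 2 <=
      beta * lambda k.+1 * `|x k.+2 - x k.+1| ^+ 2.
    by rewrite ler_wpM2r ?sqr_ge0// ler_wpM2l// ltW.
  have g0 : 0 < beta * (lambda k / 2) by rewrite mulr_gt0// divr_gt0.
  rewrite -(ler_pM2l g0).
  have -> : beta * (lambda k / 2) * (2 * c / beta * lambda k * `|x k.+1 - x k| ^+ 2) =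
     c * (lambda k * `|x k.+1 - x k|) ^+ 2 by field; rewrite gt_eqF.
  lra.
Qed.

End PL.
End RunRates.

(** * Confinement near a strict minimiser *)

Section Confinement.
Context {R : realType} {V : completeNormedModType R}.
Variables (ip : {dot V for idfun}) (f : V -> R^o) (psi : V -> \bar R)
  (H : V -> V -> V -> R) (alpha beta Lambda0 : R).
Hypotheses (ipn : hilbert_norm ip) (fd : forall x, differentiable f x)
  (psiP : proper_function psi) (psi_cvx : econvex_on setT psi)
  (psi_lsc : lower_semicontinuous psi)
  (Hs : forall x, symmetric_bounded_operator (H x))
  (alpha12 : 0 < alpha <= 1 / 2) (beta12 : 0 < beta <= 1 / 2)
  (Lambda00 : 0 < Lambda0).

Local Notation F := (objective f psi).

Variables (x : nat -> V) (dF : nat -> V -> R) (lambda : nat -> R).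
Hypothesis (run : leap_ssn_run ip f psi H alpha beta Lambda0 x dF lambda).
Variables (xs : V) (rc : R).
Hypotheses (hess : forall y, ball xs rc y -> is_hessian f H y)
  (f_cvx : convex_function (ball xs rc) f).

Variables (s t mu v : R).
Hypotheses (src : s <= rc) (mu0 : 0 < mu) (t0 : 0 < t)
  (s_step : t * (1 + 4 / alpha) < s) (s_first : t * (1 + mu / Lambda0) < s)
  (growth : forall y, `|y - xs| < s -> edom F y ->
     mu / 2 * `|y - xs| ^+ 2 <= fine (F y) - v)
  (x0_close : fine (F (x 0%N)) - v <= mu / 2 * t ^+ 2)
  (x0_s : `|x 0%N - xs| < s)
  (dF0_le : dual_norm (dF 0%N) <= mu * t).

(** Descent and quadratic growth improve membership in the ball of radius [s] to
    membership in the ball of radius [t]. *)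
Lemma run_confined_sub k : `|x k - xs| < s -> `|x k - xs| <= t.
Proof.
have mu0' := mu0; have t0' := t0.
move=> /growth/(_ (run_edom psiP run k)) h.
have := run_nonincreasing psiP beta12 Lambda00 run (leq0n k) => h2.
have m2 : 0 < mu / 2 by rewrite divr_gt0.
rewrite -ler_sqr ?nnegrE ?(ltW t0)// -(ler_pM2l m2).
by apply: le_trans h _; move: x0_close; lra.
Qed.

(** From the ball of radius [t] a step cannot leave the ball of radius [s]: the first
    step has length at most [mu * t / Lambda0], and later ones at most
    [2 / alpha] times the previous step, itself at most [2 * t]. Then
    [run_confined_sub] returns to the smaller ball. *)
Lemma run_confined k : `|x k - xs| <= t /\ `|x k.+1 - xs| <= t.
Proof.
have /andP[a0 _] := alpha12.
have ts : t < s.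
  apply: le_lt_trans s_step; rewrite ler_peMr ?(ltW t0)// lerDl divr_ge0 ?(ltW a0)//.
have Hge0 y d : `|y - xs| <= t -> 0 <= H y d d.
  move=> yt; apply: (run_hessian_ge0 fd Hs hess f_cvx).
  by apply: le_lt_trans yt _; apply: lt_le_trans src.
have step y z c : `|y - xs| <= t -> `|z - y| <= t * c -> t * (1 + c) < s -> `|z - xs| < s.
  move=> yt zy; apply: le_lt_trans.
  by apply: le_trans (ler_distD y _ _) _; lra.
elim: k => [|k [IH1 IH2]].
  have x0t := run_confined_sub x0_s; split=> //; apply: run_confined_sub.
  apply: (step _ _ (mu / Lambda0) x0t) => //.
  have := admissible_step_le ipn fd psiP (fun d => Hge0 _ d x0t)
    (run_dF run 0) (run_admissible run 0).
  have L0 : Lambda0 <= lambda 0%N.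
    have [j [-> _ _ _ _]] := run_step run 0.
    by apply: ler_peMl; [rewrite ltW|rewrite exprn_ege1// ler1n].
  move=> h; rewrite mulrA ler_pdivlMr//.
  have := ler_wpM2r (normr_ge0 (x 1%N - x 0%N)) L0.
  by move: h dF0_le; lra.
split=> //; apply: run_confined_sub.
apply: (step _ _ (4 / alpha) IH2) => //.
have h1 := admissible_step_le ipn fd psiP (fun d => Hge0 _ d IH2)
  (run_dF run k.+1) (run_admissible run k.+1).
have h2 := run_dual_norm ipn fd Hs alpha12 Lambda00 run k.
have lk := run_lambda_gt0 Lambda00 run k.
have h3 := run_lambda_half Lambda00 run k.
have h4 : `|x k.+1 - x k| <= 2 * t.
  by apply: le_trans (dist_le_add_dist xs _ _) _; lra.
have h5 : lambda k * `|x k.+1 - x k| <= lambda k * (2 * t) by rewrite ler_wpM2l// ltW.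
have h6 : alpha * (lambda k.+1 * `|x k.+2 - x k.+1|) <= alpha * dual_norm (dF k.+1).
  by rewrite ler_wpM2l// ltW.
have h7 : alpha * (lambda k / 2 * `|x k.+2 - x k.+1|) <=
    alpha * (lambda k.+1 * `|x k.+2 - x k.+1|).
  by rewrite ler_wpM2l ?(ltW a0)// ler_wpM2r.
rewrite mulrA ler_pdivlMr// -(ler_pM2l lk); lra.
Qed.

Hypothesis (rem1 : forall y z, `|y - xs| < s -> `|z - xs| < s ->
  dual_norm (derivative_remainder f H y z) <= 1 * `|y - z|).

Lemma run_lambda_bounded k : lambda k <= Num.max (lambda 0%N) 4.
Proof.
have /andP[a0 _] := alpha12.
elim: k => [|k IH]; first by rewrite le_max lexx.
apply: le_trans (run_lambda_le ipn fd psiP psi_cvx psi_lsc Hs alpha12 beta12 Lambda00 run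
  hess f_cvx src ler01 rem1 _) _.
  have [h1 h2] := run_confined k.
  have h3 : `|x k.+1 - x k| <= 2 * t.
    by apply: le_trans (dist_le_add_dist xs _ _) _; lra.
  have : 2 / alpha * `|x k.+1 - x k| <= 2 / alpha * (2 * t).
    by rewrite ler_wpM2l// divr_ge0// ltW.
  by move: s_step; lra.
have lk := run_lambda_gt0 Lambda00 run k.
rewrite mulr1 ge_max; apply/andP; split; last by rewrite le_max lexx orbT.
by apply: le_trans IH; lra.
Qed.

Hypotheses (PL : forall k, 2 * mu * (fine (F (x k.+1)) - v) <= dual_norm (dF k.+1) ^+ 2).

(** With bounded parameters the residual at [n.+1] is at most [C] times its last
    decrease, so [n] times the residual at [n] stays bounded. *)
Lemma run_confined_cvg : x @ \oo --> xs.
Proof.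
have /andP[a0 _] := alpha12; have /andP[b0 _] := beta12.
have [h0 _] := run_confined 0.
have ts : t < s.
  apply: le_lt_trans s_step; rewrite ler_peMr ?(ltW t0)// lerDl divr_ge0 ?(ltW a0)//.
have gr k : mu / 2 * `|x k - xs| ^+ 2 <= fine (F (x k)) - v.
  apply: growth; last exact (run_edom psiP run k).
  by have [h _] := run_confined k; apply: le_lt_trans ts.
pose C := (2 * mu * alpha ^+ 2)^-1 / beta * Num.max (lambda 0%N) 4.
have C0 : 0 < C.
  rewrite !mulr_gt0 ?invr_gt0 ?mulr_gt0 ?exprn_gt0// lt_max; apply/orP; right; lra.
have dec k : fine (F (x k.+1)) - v <= C * (fine (F (x k)) - fine (F (x k.+1))).
  apply: le_trans (run_residual_decrease ipn fd psiP Hs alpha12 beta12 Lambda00 run mu0 PL k) _.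
  rewrite ler_wpM2r ?subr_ge0 ?(run_nonincreasing psiP beta12 Lambda00 run)//.
  rewrite ler_wpM2l ?run_lambda_bounded//.
  by rewrite divr_ge0 ?(ltW b0)// invr_ge0 !mulr_ge0// ?sqr_ge0// ltW.
have acc n : n%:R * (fine (F (x n)) - v) <= C * (fine (F (x 0%N)) - fine (F (x n))).
  elim: n => [|n IH]; first by rewrite mul0r subrr mulr0.
  have d := dec n.
  have : n%:R * (fine (F (x n.+1)) - v) <= n%:R * (fine (F (x n)) - v).
    by rewrite ler_wpM2l// lerB// (run_nonincreasing psiP beta12 Lambda00 run).
  rewrite -natr1; lra.
apply/cvg_ooP => e e0.
have q0 : 0 < mu / 2 * e ^+ 2 by rewrite mulr_gt0 ?divr_gt0 ?exprn_gt0.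
pose A := C * (fine (F (x 0%N)) - v) / (mu / 2 * e ^+ 2).
have v0 k : v <= fine (F (x k)).
  by rewrite -subr_ge0; apply: le_trans (gr k); rewrite mulr_ge0 ?sqr_ge0// divr_ge0// ltW.
have A0 : 0 <= A.
  by rewrite divr_ge0 ?(ltW q0)// mulr_ge0 ?(ltW C0)// subr_ge0.
exists (Num.bound A) => n An.
have nA : A < n%:R.
  by apply: lt_le_trans (archi_boundP A0) _; rewrite ler_nat.
have n0 : (0 : R) < n%:R by apply: le_lt_trans nA.
have nnb : 0 < n%:R * (mu / 2) by rewrite mulr_gt0// divr_gt0.
rewrite -(@ltr_pXn2r _ 2%N) ?nnegrE ?(ltW e0)// -(ltr_pM2l nnb).
rewrite /A ltr_pdivrMr// in nA.
have h1 : n%:R * (mu / 2 * `|x n - xs| ^+ 2) <= n%:R * (fine (F (x n)) - v).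
  by rewrite ler_wpM2l.
have h2 : C * (fine (F (x 0%N)) - fine (F (x n))) <= C * (fine (F (x 0%N)) - v).
  by rewrite ler_wpM2l ?(ltW C0)// lerB.
have := acc n; lra.
Qed.

End Confinement.

Theorem theorem6p4 (R : realType) (V : completeNormedModType R)
    (ip : {dot V for idfun}) (f : V -> R^o) (psi : V -> \bar R) (Fstar : R)
    (H : V -> V -> V -> R) (L m alpha beta Lambda0 : R) (xs : V)
    (F := objective f psi) (Sol := solution_set f psi Fstar)
    (run := leap_ssn_run ip f psi H alpha beta Lambda0) :
  hilbert_norm ip ->
  finite_dimensional V ->
  C11 f ->
  proper_function psi ->
  econvex_on setT psi ->
  lower_semicontinuous psi ->
  (forall x, (Fstar%:E <= F x)%E) ->
  Sol !=set0 ->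
  (forall x, symmetric_bounded_operator (H x)) ->
  0 <= L ->
  subproblem_assumption ip f psi H L ->
  C2_convex_near f H xs ->
  1 <= m ->
  0 < alpha <= 1 / 2 ->
  0 < beta <= (m - 1) / (2 * m) ->
  0 < Lambda0 ->
  [/\
      forall x dF lambda, run x dF lambda ->
        x @ \oo --> xs -> lambda @ \oo --> (0 : R),
      forall x dF lambda, run x dF lambda ->
        remainder_bound f H L setT ->
        x @ \oo --> xs ->
        (fun k => \big[Num.min/dual_norm (dF 1%N)]_(0 <= i < k)
                    dual_norm (dF i.+1) : R^o)
          =o_\oo (fun k => (Num.sqrt k%:R)^-1 : R^o),
      forall x dF lambda, run x dF lambda ->
        remainder_bound f H L setT ->
        forall mu : R, 0 < mu ->
        (forall y, edom F y -> (F y - Fstar%:E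
           <= ((2 * mu)^-1)%:E * subdifferential_dist f psi y ^+ 2)%E) ->
        x @ \oo --> xs ->
        [/\ superlinear (fun k => fine (F (x k)) - Fstar),
            superlinear (fun k => `|x k - xs|) &
            F xs = Fstar%:E],
      forall x dF lambda, run x dF lambda ->
        remainder_bound f H L setT ->
        let F0 := [set y | edom F y /\ (F y <= F (x 0%N))%E] in
        bounded_set F0 ->
        econvex_on F0 F ->
        x @ \oo --> xs ->
        (fun k => fine (F (x k)) - Fstar : R^o)
          =o_\oo (fun k => k%:R^-1 : R^o) &
      forall r mu : R, 0 < r -> 0 < mu ->
        isolated_local_minimum F xs ->
        (forall y, closed_ball xs r y ->
           (F xs <= F y)%E /\ dist_to Sol y = `|y - xs|) ->
        remainder_bound f H L (closed_ball xs r) ->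
        (forall y, closed_ball xs r y -> (F y - F xs
           <= ((2 * mu)^-1)%:E * subdifferential_dist f psi y ^+ 2)%E) ->
        (forall y, closed_ball xs r y ->
           forall d, mu * `|d| ^+ 2 <= H y d d) ->
        (forall y, closed_ball xs r y ->
           ((mu / 2 * dist_to Sol y ^+ 2)%:E <= F y - F xs)%E) ->
        exists2 Delta : R, 0 < Delta &
          forall x dF lambda, run x dF lambda ->
            closed_ball xs r (x 0%N) -> dual_norm (dF 0%N) <= Delta ->
            superlinear (fun k => `|x k - xs|) /\
            superlinear (fun k => fine (F (x k)) - fine (F xs))].
Proof.
move=> ipn _ [fd _] psiP psi_cvx psi_lsc F_ge SolN Hs L0 _ [rc rc0 [C2 f_cvx]].
move=> m1 alpha12 beta_m Lambda00.
have hess y : ball xs rc y -> is_hessian f H y by move=> /C2[].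
have hcont y : ball xs rc y -> operator_continuous_at H y by move=> /C2[].
have /andP[a0 a12] := alpha12.
have beta12 : 0 < beta <= 1 / 2.
  case/andP: beta_m => -> /= /le_trans; apply.
  have m0 : 0 < 2 * m by lra.
  by rewrite ler_pdivrMr//; lra.
have /andP[b0 b12] := beta12.
have lam_cvg x dF lambda : run x dF lambda -> x @ \oo --> xs -> lambda @ \oo --> (0 : R).
  move=> xrun; exact: (run_lambda_cvg0 ipn fd psiP psi_cvx psi_lsc Hs
    alpha12 beta12 Lambda00 xrun hess f_cvx rc0 hcont).
have Fstar_le x dF lambda : run x dF lambda -> forall k, Fstar <= fine (F (x k)).
  by move=> xrun k; have := F_ge (x k); rewrite /F (run_fineF psiP xrun k) lee_fin.
split.
- by move=> x dF lambda; exact: lam_cvg.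
- move=> x dF lambda xrun _ xxs.
  exact: (run_min_dual_norm_littleo ipn fd psiP Hs alpha12 beta12 Lambda00 xrun
    (lam_cvg _ _ _ xrun xxs) (Fstar_le _ _ _ xrun)).
- move=> x dF lambda xrun _ mu mu0 PL xxs.
  have lamc := lam_cvg _ _ _ xrun xxs.
  have v_le := Fstar_le _ _ _ xrun.
  have PLk k : 2 * mu * (fine (F (x k.+1)) - Fstar) <= dual_norm (dF k.+1) ^+ 2.
    apply: (PL_dual_norm fd psiP mu0 (run_edom psiP xrun _) (run_dF xrun _)).
    exact: PL (run_edom psiP xrun _).
  split.
  + exact: (run_residual_superlinear ipn fd psiP Hs alpha12 beta12 Lambda00
      xrun mu0 v_le PLk lamc).
  + exact: (run_iterates_superlinear ipn fd psiP Hs alpha12 beta12 Lambda00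
      xrun mu0 v_le PLk lamc xxs).
  + apply/eqP; rewrite eq_le F_ge andbT.
    apply: (lsc_objective_limit fd psi_lsc xxs
      (run_residual_cvg ipn fd psiP Hs alpha12 beta12 Lambda00
      xrun mu0 v_le PLk lamc)).
    by move=> k; exact (run_fineF psiP xrun k).
- move=> x dF lambda xrun _ F0 F0b F0cvx xxs.
  have [u uSol] := SolN; have Su : F u = Fstar%:E by [].
  have [M _ MP] := ex_strict_bound_gt0 F0b.
  have F0x k : F0 (x k).
    split; first exact (run_edom psiP xrun k).
    rewrite /F (run_fineF psiP xrun k) (run_fineF psiP xrun 0) lee_fin.
    by rewrite (run_nonincreasing psiP beta12 Lambda00 xrun).
  have udom : edom F u by apply: (@le_lt_trans _ _ Fstar%:E); [rewrite Su|rewrite ltry].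
  have F0u : F0 u by split=> //; rewrite Su; exact: F_ge.
  exact: (run_convex_residual_littleo ipn fd psiP Hs alpha12 beta12 Lambda00 xrun
    (lam_cvg _ _ _ xrun xxs) (Fstar_le _ _ _ xrun)
    F0cvx F0x F0u Su (fun y yF => ltW (MP y yF))).
- move=> r mu r0 mu0 [[xsdom _] _] minS rem PL _ growth.
  have [rho /andP[rho0 rhor] rem1] := uniform_remainder fd Hs rc0 C2 ltr01.
  pose s := Num.min rho r.
  have s0 : 0 < s by rewrite lt_min rho0.
  have cbP y : `|y - xs| <= r -> closed_ball xs r y.
    by move=> yr; rewrite closed_ballE// /closed_ball_ /= distrC.
  have cbP' y : closed_ball xs r y -> `|y - xs| <= r.
    by rewrite closed_ballE// /closed_ball_ /= distrC.
  have FxsE := fineF psiP xsdom.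
  set v := fine (F xs).
  have vE : F xs = v%:E by rewrite /v /F FxsE.
  have D0 : 0 < 2 + 4 / alpha + mu / Lambda0 by rewrite !addr_gt0 ?divr_gt0.
  (* the ball of radius [t] leaves room inside the ball of radius [s] for both kinds
     of step bounded in [run_confined] *)
  pose t := s / (2 + 4 / alpha + mu / Lambda0).
  have t0 : 0 < t by rewrite divr_gt0.
  have tE : t * (2 + 4 / alpha + mu / Lambda0) = s by rewrite /t mulfVK// gt_eqF.
  have ta : 0 < t * (4 / alpha) by rewrite mulr_gt0// divr_gt0.
  have tm : 0 < t * (mu / Lambda0) by rewrite mulr_gt0// divr_gt0.
  have s_step : t * (1 + 4 / alpha) < s by lra.
  have s_first : t * (1 + mu / Lambda0) < s by lra.
  have ts : t < s by lra.
  have grow y : `|y - xs| <= r -> edom F y -> mu / 2 * `|y - xs| ^+ 2 <= fine (F y) - v.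
    move=> yr ydom; have := growth _ (cbP _ yr).
    rewrite (minS _ (cbP _ yr)).2 vE.
    by rewrite /F (fineF psiP ydom) -EFinB lee_fin.
  have PLr x dF lambda k : run x dF lambda -> `|x k - xs| <= r ->
      2 * mu * (fine (F (x k)) - v) <= dual_norm (dF k) ^+ 2.
    move=> xrun xr.
    apply: (PL_dual_norm fd psiP mu0 (run_edom psiP xrun _) (run_dF xrun _)).
    by rewrite -vE; exact: PL (cbP _ xr).
  exists (mu * t); first by rewrite mulr_gt0.
  move=> x dF lambda xrun /cbP' x0r dF0.
  have gnn : 0 <= dual_norm (dF 0%N) by apply: dual_norm_ge0; exact (run_dual_elt fd xrun 0).
  have x0_close : fine (F (x 0%N)) - v <= mu / 2 * t ^+ 2.
    have h1 := PLr _ _ _ 0 xrun x0r.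
    have h2 : dual_norm (dF 0%N) ^+ 2 <= (mu * t) ^+ 2.
      by rewrite ler_sqr ?nnegrE// mulr_ge0 ?(ltW mu0) ?(ltW t0).
    rewrite exprMn in h2.
    rewrite -(ler_pM2l (_ : 0 < 2 * mu)) ?mulr_gt0//; lra.
  have x0_t : `|x 0%N - xs| <= t.
    have h := grow _ x0r (run_edom psiP xrun 0).
    have m2 : 0 < mu / 2 by rewrite divr_gt0.
    by rewrite -ler_sqr ?nnegrE ?(ltW t0)// -(ler_pM2l m2) (le_trans h).
  have sr y : `|y - xs| < s -> `|y - xs| <= r by rewrite lt_min => /andP[_ /ltW].
  have srho y : `|y - xs| < s -> `|y - xs| < rho by rewrite lt_min => /andP[].
  have src : s <= rc by rewrite (le_trans _ rhor)// ge_min lexx.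
  have growth' y : `|y - xs| < s -> edom F y -> mu / 2 * `|y - xs| ^+ 2 <= fine (F y) - v.
    by move=> /sr; exact: grow.
  have x0_s := le_lt_trans x0_t ts.
  have conf := run_confined ipn fd psiP Hs alpha12 beta12 Lambda00 xrun
    hess f_cvx src mu0 t0 s_step s_first growth' x0_close x0_s dF0.
  have kr k : `|x k - xs| <= r by apply/sr/(le_lt_trans _ ts); exact: (conf k).1.
  have PLk k := PLr _ _ _ k.+1 xrun (kr k.+1).
  have rem1' y z : `|y - xs| < s -> `|z - xs| < s ->
      dual_norm (derivative_remainder f H y z) <= 1 * `|y - z|.
    by move=> /srho yr /srho zr; exact: rem1.
  have xxs := run_confined_cvg ipn fd psiP psi_cvx psi_lsc Hs alpha12 beta12 Lambda00 xrun
    hess f_cvx src mu0 t0 s_step s_first growth' x0_close x0_s dF0 rem1' PLk.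
  have lamc := lam_cvg _ _ _ xrun xxs.
  have v_le k : v <= fine (F (x k)).
    rewrite -subr_ge0; apply: le_trans (grow _ (kr k) (run_edom psiP xrun k)).
    by rewrite mulr_ge0 ?sqr_ge0// divr_ge0// ltW.
  split.
  + exact: (run_iterates_superlinear ipn fd psiP Hs alpha12 beta12 Lambda00
      xrun mu0 v_le PLk lamc xxs).
  + exact: (run_residual_superlinear ipn fd psiP Hs alpha12 beta12 Lambda00
      xrun mu0 v_le PLk lamc).
Qed.
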